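(* Let $S/R$ with its commuting actions of $\sigma$ and $\tau$ be the generic extension constructed in the context. Suppose $R_1$ is a semilocal commutative ring and $S_1/R_1$ is a Galois extension with group $C_p=\langle\sigma\rangle$. Then there is a ring homomorphism $\psi:R^{\tau}\to R_1$ such that $S_1\cong S^{\tau}\otimes_{R^\tau,\psi}R_1$ as $C_p$ Galois extensions of $R_1$.
   Context: $p$ is a prime, $\rho$ is a primitive $p$-th root of one, $\mathbb{Z}[\rho]=\mathbb{Z}[X]/(X^{p-1}+\cdots+1)$, $\eta=\rho-1$. There is a unit $\xi\in\mathbb{Z}[\rho]^*$ with $p=\xi\eta^{p-1}$. Put $b_i=\binom{p}{i}/p$ for $1\le i\le p-1$ and $g(Z)=\xi\sum_{i=1}^{p-1} b_i\eta^{i-1}Z^i\in\mathbb{Z}[\rho][Z]$. $\tau$ is the automorphism of $\mathbb{Z}[\rho]$ induced by a generator of $\mathrm{Gal}(\mathbb{Q}(\rho)/\mathbb{Q})$; $s$ is a positive integer with $\tau(\rho)=\rho^s$, chosen so that $s^{p-1}-1=pr$ with $r$ prime to $p$; $\delta=(\rho^s-1)/(\rho-1)=1+\rho+\cdots+\rho^{s-1}$, a unit of $\mathbb{Z}[\rho]$. In any commutative $\mathbb{Z}[\rho]$-algebra: $x\oplus y=x+y+xy\eta$; if $1+y\eta$ is a unit, $x\ominus y$ is the unique $w$ with $x=y\oplus w$, i.e. $(x-y)/(1+y\eta)$; $x\oplus_py=x+y+xy\eta^p$; for a positive integer $n$, $n*x=x\oplus\cdots\oplus x$ and $n*_px=x\oplus_p\cdots\oplus_px$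 ($n$ summands each). Write $\delta^p\tau$ for the map $w\mapsto\delta^p\cdot\tau(w)$. Define $$N(z)=(s^{p-2}*_pz)\oplus_p(s^{p-3}*_p\delta^p\tau(z))\oplus_p\cdots\oplus_p(s*_p(\delta^p\tau)^{p-3}(z))\oplus_p(\delta^p\tau)^{p-2}(z).$$ The generic extension: let $R'=\mathbb{Z}[\rho][x_0,\ldots,x_{p-2}]$ with $\tau(x_i)=x_i$, $z=\sum_{i=0}^{p-2}x_i\rho^i$, $C=\prod_{i=0}^{p-2}\tau^i(1+z\eta^p)$, $R=R'[1/C]$, $u=N(z)$, $S=R[Z]/(Z^p+g(Z)-u)$, $\theta$ the image of $Z$. Then $S/R$ is $\langle\sigma\rangle$ Galois with $\sigma(\theta)=\rho\theta+1$; $\tau$ extends to $S$ by $\tau(\theta)=\frac1\delta((s*\theta)\ominus(r*_pz)\eta^{p-1})$, with $\tau^{p-1}=1$ and $\sigma\tau=\tau\sigma$; $R^\tau=\mathbb{Z}[x_0,\ldots,x_{p-2}][1/C]$, and $S^\tau/R^\tau$ is Galois with group $\langle\sigma\rangle\cong C_p$. ''Galois'' is in the sense of Galois extensions of commutative rings; isomorphisms of $C_p$ Galois extensions are algebra isomorphisms over the base commuting with the $C_p$-actions. *)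

(* Defs.v *)
From HB Require Import structures.
From mathcomp Require Import all_boot all_algebra.
From mathcomp.classical Require Import boolp.
From mathcomp.multinomials Require Import mpoly.

Set Implicit Arguments.
Unset Strict Implicit.
Unset Printing Implicit Defensive.

Import GRing.Theory.
Local Open Scope ring_scope.
Local Open Scope quotient_scope.

(* Rings are [comPzRingType]s (the zero ring is allowed) except where
   polynomials are formed over them. *)

Section SemiLocal.
Variable A : comPzRingType.

Definition is_ideal (I : A -> Prop) : Prop :=
  [/\ I 0, forall x y, I x -> I y -> I (x + y) & forall a x, I x -> I (a * x)].

Definition is_maximal_ideal (I : A -> Prop) : Prop :=
  [/\ is_ideal I, ~ I 1 &
      forall J : A -> Prop, is_ideal J -> ~ J 1 ->
        (forall x, I x -> J x) -> forall x, J x -> I x].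

Definition semilocal : Prop :=
  exists (n : nat) (M : 'I_n -> A -> Prop),
    forall I : A -> Prop, is_maximal_ideal I ->
      exists i : 'I_n, forall x, I x <-> M i x.

End SemiLocal.

Definition is_unit (A : comPzRingType) (x : A) : Prop := exists y, x * y = 1.

(* [f : A -> B] exhibits [B] as the localization [A[1/c]]. *)
Definition is_localization_at (A B : comPzRingType) (c : A)
    (f : {rmorphism A -> B}) : Prop :=
  [/\ is_unit (f c),
      forall y : B, exists (x : A) (k : nat), y * f c ^+ k = f x &
      forall x : A, f x = 0 -> exists k : nat, c ^+ k * x = 0].

Section FixedRing.
Variables (A : comPzRingType) (f : {rmorphism A -> A}).

Definition fixed_pred (x : A) : bool := f x == x.

Fact fixed_subring_closed : subring_closed fixed_pred.
Proof.
split=> [|x y|x y]; rewrite !unfold_in /fixed_pred; first by rewrite rmorph1.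
  by move=> /eqP fx /eqP fy; rewrite rmorphB fx fy.
by move=> /eqP fx /eqP fy; rewrite rmorphM fx fy.
Qed.

HB.instance Definition _ :=
  GRing.isSubringClosed.Build A fixed_pred fixed_subring_closed.

Record fixed_ring : predArgType := FixedRing {
  fixed_val :> A;
  _ : fixed_val \in fixed_pred }.

HB.instance Definition _ := [isSub for fixed_val].
HB.instance Definition _ := [Choice of fixed_ring by <:].
HB.instance Definition _ := GRing.SubChoice_isSubComPzRing.Build
  A fixed_pred fixed_ring fixed_subring_closed.

Lemma fixed_ringP (x : fixed_ring) : f (val x) = val x.
Proof. by apply/eqP; case: x. Qed.

End FixedRing.

Section FixedMorph.
Variables (A B : comPzRingType).
Variables (f : {rmorphism A -> A}) (g : {rmorphism B -> B}).
Variables (h : {rmorphism A -> B}) (hfg : forall x, g (h x) = h (f x)).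

Fact fixed_morph_subproof (x : fixed_ring f) : h (val x) \in fixed_pred g.
Proof. by rewrite unfold_in /fixed_pred hfg fixed_ringP. Qed.

Definition fixed_morph (x : fixed_ring f) : fixed_ring g :=
  FixedRing (fixed_morph_subproof x).

Fact fixed_morph_is_zmod_morphism : zmod_morphism fixed_morph.
Proof. by move=> x y; apply: val_inj; rewrite /= !rmorphB. Qed.

Fact fixed_morph_is_monoid_morphism : monoid_morphism fixed_morph.
Proof.
by split=> [|x y]; apply: val_inj; rewrite /= ?rmorph1 ?rmorphM.
Qed.

HB.instance Definition _ := GRing.isZmodMorphism.Build
  (fixed_ring f) (fixed_ring g) fixed_morph fixed_morph_is_zmod_morphism.
HB.instance Definition _ := GRing.isMonoidMorphism.Build
  (fixed_ring f) (fixed_ring g) fixed_morph fixed_morph_is_monoid_morphism.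

End FixedMorph.

Section Tensor.
Variables (A B C : comPzRingType).
Variables (f : {rmorphism A -> B}) (g : {rmorphism A -> C}).

(* A list [:: (b1, c1); ...; (bn, cn)] stands for the sum of the bi (x) ci in
   the tensor product of B and C over A. *)
Inductive tens_rel : seq (B * C) -> seq (B * C) -> Prop :=
| tens_refl s : tens_rel s s
| tens_sym s t : tens_rel s t -> tens_rel t s
| tens_trans s t u : tens_rel s t -> tens_rel t u -> tens_rel s u
| tens_cat s t s' t' :
    tens_rel s t -> tens_rel s' t' -> tens_rel (s ++ s') (t ++ t')
| tens_catC s t : tens_rel (s ++ t) (t ++ s)
| tens_0l c : tens_rel [:: (0, c)] [::]
| tens_Dl b b' c : tens_rel [:: (b + b', c)] [:: (b, c); (b', c)]
| tens_Dr b c c' : tens_rel [:: (b, c + c')] [:: (b, c); (b, c')]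
| tens_bal a b c : tens_rel [:: (b * f a, c)] [:: (b, g a * c)].

Definition tens_eq : rel (seq (B * C)) := fun s t => `[< tens_rel s t >].

Fact tens_eq_equiv : equiv_class_of tens_eq.
Proof.
split=> [s|s t|t s u]; first by apply/asboolP; apply: tens_refl.
  by apply: asbool_equiv_eq; split; apply: tens_sym.
by move=> /asboolP st /asboolP tu; apply/asboolP; apply: tens_trans st tu.
Qed.

Canonical tens_eq_equiv_rel := EquivRelPack tens_eq_equiv.

Definition tensor : Type := {eq_quot tens_eq}.
HB.instance Definition _ := Choice.on tensor.

Definition tens_pi (s : seq (B * C)) : tensor := \pi_tensor s.

Definition pure (b : B) (c : C) : tensor := tens_pi [:: (b, c)].

Lemma tens_piP s t : tens_pi s = tens_pi t <-> tens_rel s t.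
Proof.
split=> [/eqP|st]; first by rewrite eqmodE => /asboolP.
by apply/eqP; rewrite eqmodE; apply/asboolP.
Qed.

Lemma tens_pi_repr x : tens_pi (repr x) = x.
Proof. exact: reprK. Qed.

Definition tens_oppl (s : seq (B * C)) := [seq (- x.1, x.2) | x <- s].
Definition tens_mull (s t : seq (B * C)) :=
  [seq (x.1 * y.1, x.2 * y.2) | x <- s, y <- t].

Definition tens_zero : tensor := tens_pi [::].
Definition tens_one : tensor := pure 1 1.
Definition tens_add (x y : tensor) : tensor := tens_pi (repr x ++ repr y).
Definition tens_opp (x : tensor) : tensor := tens_pi (tens_oppl (repr x)).
Definition tens_mul (x y : tensor) : tensor :=
  tens_pi (tens_mull (repr x) (repr y)).

Lemma tens_repr s : tens_rel (repr (tens_pi s)) s.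
Proof. by apply/tens_piP; apply: tens_pi_repr. Qed.

Lemma tens_add_pi s t : tens_add (tens_pi s) (tens_pi t) = tens_pi (s ++ t).
Proof. by apply/tens_piP; apply: tens_cat; apply: tens_repr. Qed.

Lemma tens_0r b : tens_rel [:: (b, 0)] [::].
Proof.
have := tens_bal 0 b 0; rewrite !rmorph0 mul0r mulr0 => e.
exact: tens_trans (tens_sym e) (tens_0l 0).
Qed.

Lemma tens_rel_opp s t : tens_rel s t -> tens_rel (tens_oppl s) (tens_oppl t).
Proof.
elim=> {s t} [s|s t _|s t u _ IH _ IH'|s t s' t' _ IH _ IH'|s t|c|b b' c|b c c'
  |a b c] /=.
- exact: tens_refl.
- exact: tens_sym.
- exact: tens_trans IH IH'.
- by rewrite /tens_oppl !map_cat; apply: tens_cat.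
- by rewrite /tens_oppl !map_cat; apply: tens_catC.
- by rewrite oppr0; apply: tens_0l.
- by rewrite opprD; apply: tens_Dl.
- exact: tens_Dr.
- by rewrite -mulNr; apply: tens_bal.
Qed.

Lemma tens_opp_pi s : tens_opp (tens_pi s) = tens_pi (tens_oppl s).
Proof. by apply/tens_piP; apply: tens_rel_opp; apply: tens_repr. Qed.

Lemma tens_rel_oppl s : tens_rel (tens_oppl s ++ s) [::].
Proof.
elim: s => [|[b c] s IH] /=; first exact: tens_refl.
have H : tens_rel [:: (- b, c); (b, c)] [::].
  apply: tens_trans (tens_sym (tens_Dl _ _ _)) _.
  by rewrite addNr; apply: tens_0l.
apply: tens_trans (tens_cat H IH).
apply: (@tens_cat [:: (- b, c)] [:: (- b, c)]); first exact: tens_refl.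
rewrite -[(b, c) :: s]cat1s catA -[X in tens_rel _ X]cat1s catA.
by apply: tens_cat; [apply: tens_catC | apply: tens_refl].
Qed.

Lemma tens_mull_consr s x t :
  tens_rel (tens_mull s (x :: t)) (tens_mull s [:: x] ++ tens_mull s t).
Proof.
elim: s => [|y s IH]; first exact: tens_refl.
rewrite /tens_mull !allpairs_cons /= -/(tens_mull _ _).
apply: (@tens_cat [:: _] [:: _]); first exact: tens_refl.
apply: tens_trans (tens_cat (tens_refl _) IH) _.
rewrite /tens_mull !catA; apply: tens_cat; last exact: tens_refl.
exact: tens_catC.
Qed.

Lemma tens_mullC s t : tens_rel (tens_mull s t) (tens_mull t s).
Proof.
elim: s => [|x s IH] in t *.
  by elim: t => [|y t IHt]; [apply: tens_refl | apply: IHt].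
apply: tens_trans (tens_sym (tens_mull_consr t x s)).
rewrite /tens_mull allpairs_cons; apply: tens_cat; last exact: IH.
elim: t => [|y t IHt] /=; first exact: tens_refl.
apply: (@tens_cat [:: _] [:: _]) => //.
by rewrite [x.1 * _]mulrC [x.2 * _]mulrC; apply: tens_refl.
Qed.

Lemma tens_rel_mull s t u :
  tens_rel s t -> tens_rel (tens_mull s u) (tens_mull t u).
Proof.
elim=> {s t} [s|s t _|s t v _ IH _ IH'|s t s' t' _ IH _ IH'|s t|c|b b' c|b c c'
  |a b c] /=.
- exact: tens_refl.
- exact: tens_sym.
- exact: tens_trans IH IH'.
- by rewrite /tens_mull !allpairs_cat; apply: tens_cat.
- by rewrite /tens_mull !allpairs_cat; apply: tens_catC.
- rewrite /tens_mull /= cats0; elim: u => [|y u IH] /=; first exact: tens_refl.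
  by rewrite mul0r; apply: (@tens_cat [:: _] [::]) IH; apply: tens_0l.
- rewrite /tens_mull /= !cats0; elim: u => [|y u IH] /=; first exact: tens_refl.
  have := tens_Dl (b * y.1) (b' * y.1) (c * y.2); rewrite -mulrDl => e.
  apply: tens_trans (tens_cat e IH) _ => /=.
  apply: (@tens_cat [:: _] [:: _]); first exact: tens_refl.
  rewrite -cat1s catA -[X in tens_rel _ (_ ++ X)]cat1s catA.
  by apply: tens_cat; [apply: tens_catC | apply: tens_refl].
- rewrite /tens_mull /= !cats0; elim: u => [|y u IH] /=; first exact: tens_refl.
  have := tens_Dr (b * y.1) (c * y.2) (c' * y.2); rewrite -mulrDl => e.
  apply: tens_trans (tens_cat e IH) _ => /=.
  apply: (@tens_cat [:: _] [:: _]); first exact: tens_refl.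
  rewrite -cat1s catA -[X in tens_rel _ (_ ++ X)]cat1s catA.
  by apply: tens_cat; [apply: tens_catC | apply: tens_refl].
- rewrite /tens_mull /= !cats0; elim: u => [|y u IH] /=; first exact: tens_refl.
  apply: (@tens_cat [:: _] [:: _]) IH.
  by rewrite mulrAC -(mulrA (g a)); apply: tens_bal.
Qed.

Lemma tens_mul_pi s t : tens_mul (tens_pi s) (tens_pi t) = tens_pi (tens_mull s t).
Proof.
apply/tens_piP; apply: tens_trans (tens_rel_mull _ (tens_repr s)) _.
apply: tens_trans (tens_mullC _ _) _.
apply: tens_trans (tens_rel_mull _ (tens_repr t)) _.
exact: tens_mullC.
Qed.

Fact tens_addA : associative tens_add.
Proof.
move=> x y z; rewrite -[x]tens_pi_repr -[y]tens_pi_repr -[z]tens_pi_repr.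
by rewrite !tens_add_pi catA.
Qed.

Fact tens_addC : commutative tens_add.
Proof. by move=> x y; apply/tens_piP; apply: tens_catC. Qed.

Fact tens_add0 : left_id tens_zero tens_add.
Proof. by move=> x; rewrite -[x]tens_pi_repr tens_add_pi. Qed.

Fact tens_addN : left_inverse tens_zero tens_opp tens_add.
Proof.
move=> x; rewrite -[x]tens_pi_repr tens_opp_pi tens_add_pi.
by apply/tens_piP; apply: tens_rel_oppl.
Qed.

HB.instance Definition _ :=
  GRing.isZmodule.Build tensor tens_addA tens_addC tens_add0 tens_addN.

Lemma tens_piD s t : tens_pi s + tens_pi t = tens_pi (s ++ t).
Proof. exact: tens_add_pi. Qed.

Fact tens_mulA : associative tens_mul.
Proof.
move=> x y z; rewrite -[x]tens_pi_repr -[y]tens_pi_repr -[z]tens_pi_repr.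
rewrite !tens_mul_pi; congr tens_pi; rewrite /tens_mull.
elim: (repr x) => [|[b c] s IH] //.
rewrite !allpairs_cons allpairs_cat -IH; congr (_ ++ _).
elim: (repr y) => [|[b' c'] t IH'] //=.
rewrite map_cat IH'; congr (_ ++ _).
by rewrite -map_comp; apply: eq_map => -[b'' c''] /=; rewrite !mulrA.
Qed.

Fact tens_mulC : commutative tens_mul.
Proof.
by move=> x y; apply/tens_piP; apply: tens_mullC.
Qed.

Fact tens_mul1 : left_id tens_one tens_mul.
Proof.
move=> x; rewrite -[x]tens_pi_repr tens_mul_pi /tens_mull /= cats0.
by congr tens_pi; elim: (repr x) => [|[b c] s /= ->] //=; rewrite !mul1r.
Qed.

Fact tens_mulD : left_distributive tens_mul +%R.
Proof.
move=> x y z; rewrite -[x]tens_pi_repr -[y]tens_pi_repr -[z]tens_pi_repr.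
rewrite !(tens_piD, tens_mul_pi).
by rewrite /tens_mull allpairs_cat.
Qed.

HB.instance Definition _ := GRing.Zmodule_isComPzRing.Build tensor
  tens_mulA tens_mulC tens_mul1 tens_mulD.

Lemma tens_piM s t : tens_pi s * tens_pi t = tens_pi (tens_mull s t).
Proof. exact: tens_mul_pi. Qed.

Definition tens_inr (c : C) : tensor := pure 1 c.

Fact tens_inr_is_zmod_morphism : zmod_morphism tens_inr.
Proof.
have D x y : tens_inr (x + y) = tens_inr x + tens_inr y.
  by rewrite tens_piD; apply/tens_piP; apply: tens_Dr.
by move=> x y; apply/eqP; rewrite eq_sym subr_eq -D subrK.
Qed.

Fact tens_inr_is_monoid_morphism : monoid_morphism tens_inr.
Proof.
by split=> // x y; rewrite tens_piM /tens_mull /= mulr1.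
Qed.

HB.instance Definition _ := GRing.isZmodMorphism.Build C tensor tens_inr
  tens_inr_is_zmod_morphism.
HB.instance Definition _ := GRing.isMonoidMorphism.Build C tensor tens_inr
  tens_inr_is_monoid_morphism.

End Tensor.

Section TensorMap.
Variables (A B C : comPzRingType).
Variables (f : {rmorphism A -> B}) (g : {rmorphism A -> C}).
Variables (s : {rmorphism B -> B}) (sf : forall a, s (f a) = f a).

Local Notation T := (tensor f g).
Local Notation smap u := [seq (s x.1, x.2) | x <- u].

(* The endomorphism s (x) id. *)
Definition tens_mapl_fun (x : T) : T := tens_pi f g (smap (repr x)).

Lemma tens_rel_mapl u v :
  tens_rel f g u v -> tens_rel f g (smap u) (smap v).
Proof.
elim=> {u v}
  [u|u t _|u t v _ IH _ IH'|u t u' t' _ IH _ IH'|u t|c|b b' c|b c c'|a b c] /=.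
- exact: tens_refl.
- exact: tens_sym.
- exact: tens_trans IH IH'.
- by rewrite !map_cat; apply: tens_cat.
- by rewrite !map_cat; apply: tens_catC.
- by rewrite rmorph0; apply: tens_0l.
- by rewrite rmorphD; apply: tens_Dl.
- exact: tens_Dr.
- by rewrite rmorphM sf; apply: tens_bal.
Qed.

Lemma tens_mapl_pi u : tens_mapl_fun (tens_pi f g u) = tens_pi f g (smap u).
Proof. by apply/tens_piP; apply: tens_rel_mapl; apply: tens_repr. Qed.

Fact tens_mapl_is_zmod_morphism : zmod_morphism tens_mapl_fun.
Proof.
have D x y : tens_mapl_fun (x + y) = tens_mapl_fun x + tens_mapl_fun y.
  rewrite -[x]tens_pi_repr -[y]tens_pi_repr.
  by rewrite !(tens_piD, tens_mapl_pi) map_cat.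
by move=> x y; apply/eqP; rewrite eq_sym subr_eq -D subrK.
Qed.

Fact tens_mapl_is_monoid_morphism : monoid_morphism tens_mapl_fun.
Proof.
split=> [|x y]; first by rewrite [LHS]tens_mapl_pi /= rmorph1.
rewrite -[x]tens_pi_repr -[y]tens_pi_repr.
rewrite !(tens_piM, tens_mapl_pi) /tens_mull; congr tens_pi.
elim: (repr x) => [|[b c] u IH] //.
rewrite !allpairs_cons map_cat IH; congr (_ ++ _).
by rewrite -!map_comp; apply: eq_map => -[b' c'] /=; rewrite rmorphM.
Qed.

Definition tens_mapl : {rmorphism T -> T} :=
  HB.pack tens_mapl_fun
    (GRing.isZmodMorphism.Build T T tens_mapl_fun tens_mapl_is_zmod_morphism)
    (GRing.isMonoidMorphism.Build T T tens_mapl_fun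
       tens_mapl_is_monoid_morphism).

Lemma tens_mapl_inr c : tens_mapl (tens_inr f g c) = tens_inr f g c.
Proof. by rewrite [LHS]tens_mapl_pi /= rmorph1. Qed.

End TensorMap.

(* A commutative algebra over A together with an algebra endomorphism, the
   action of the chosen generator of the cyclic group. *)
Record cyclic_alg (A : comPzRingType) := CyclicAlg {
  ca_ring :> comPzRingType;
  ca_struct : {rmorphism A -> ca_ring};
  ca_act : {rmorphism ca_ring -> ca_ring};
  ca_act_struct : forall a, ca_act (ca_struct a) = ca_struct a }.

(* E/A is Galois with group <sigma> cyclic of order p: A is the ring of
   invariants, and there are x_i, y_i with sum_i x_i g(y_i) = delta_(g,1). *)
Definition is_Galois (p : nat) (A : comPzRingType) (E : cyclic_alg A) : Prop :=
  [/\ forall x : E, iter p (ca_act E) x = x,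
      injective (ca_struct E),
      forall x : E, ca_act E x = x -> exists a, x = ca_struct E a &
      exists w : seq (E * E), forall k, (k < p)%N ->
        \sum_(xy <- w) xy.1 * iter k (ca_act E) xy.2 = (k == 0)%:R].

Definition cyclic_alg_iso (A : comPzRingType) (E F : cyclic_alg A) : Prop :=
  exists f : {rmorphism E -> F},
    [/\ bijective f,
        forall a, f (ca_struct E a) = ca_struct F a &
        forall x, f (ca_act E x) = ca_act F (f x)].

Definition base_change (A B : comPzRingType) (E : cyclic_alg A)
    (psi : {rmorphism A -> B}) : cyclic_alg B :=
  @CyclicAlg B (tensor (ca_struct E) psi) (tens_inr (ca_struct E) psi)
    (tens_mapl psi (@ca_act_struct A E))
    (tens_mapl_inr psi (@ca_act_struct A E)).

(* x (+) y is the case e = eta, x (+)_p y the case e = eta ^+ p. *)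
Definition fg_add (A : comPzRingType) (e x y : A) : A := x + y + x * y * e.

Definition fg_muln (A : comPzRingType) (e : A) (n : nat) (x : A) : A :=
  iter n (fg_add e x) 0.

(* w = x (-) y: the unique w with x = y (+) w. *)
Definition is_fg_sub (A : comPzRingType) (e x y w : A) : Prop :=
  is_unit (1 + y * e) /\ x = fg_add e y w.

Definition cyclo_poly (p : nat) : {poly int} := \sum_(i < p) 'X^i.

Lemma cyclo_polyE p : cyclo_poly p = \poly_(i < p) 1.
Proof. by rewrite poly_def; apply: eq_bigr => i _; rewrite scale1r. Qed.

(* {poly %/ h} is the quotient by h only when h is monic of positive degree. *)
Lemma mk_monic_cyclo_poly p : prime p -> mk_monic (cyclo_poly p) = cyclo_poly p.
Proof.
move=> p_pr; have p1 := prime_gt1 p_pr.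
have szP : size (cyclo_poly p) = p.
  by rewrite cyclo_polyE; case: p p1 {p_pr} => // n _; rewrite size_poly_eq.
rewrite /mk_monic szP p1 monicE lead_coefE szP cyclo_polyE coef_poly.
by rewrite ltn_predL prime_gt0 //= eqxx.
Qed.

Notation Zrho p := {poly %/ cyclo_poly p}.

Definition rho (p : nat) : Zrho p := 'qX.
Definition eta (p : nat) : Zrho p := rho p - 1.

(* tau0 generates Gal(Q(rho)/Q), identified with the automorphism group of its
   ring of integers Z[rho]; ns and nr are the integers s and r. *)
Record cyclo_data (p : nat) := CycloData {
  xi : Zrho p;
  xi_unit : is_unit xi;
  xiE : p%:R = xi * eta p ^+ p.-1;
  tau0 : {rmorphism Zrho p -> Zrho p};
  tau0_gen : forall f : {rmorphism Zrho p -> Zrho p}, bijective f ->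
    exists k, f =1 iter k tau0;
  ns : nat;
  ns_gt0 : (0 < ns)%N;
  tau0_rho : tau0 (rho p) = rho p ^+ ns;
  nr : nat;
  nsE : (ns ^ p.-1 = (p * nr).+1)%N;
  nr_coprime : coprime nr p }.

Section PolyRing.
Variables (p : nat) (D : cyclo_data p).

Definition delta : Zrho p := \sum_(i < ns D) rho p ^+ i.

(* The division is exact for p prime and 0 < i < p. *)
Definition binom_div (i : nat) : nat := ('C(p, i) %/ p)%N.

Definition gpoly : {poly Zrho p} :=
  xi D *: \sum_(1 <= i < p) ((binom_div i)%:R * eta p ^+ i.-1) *: 'X^i.

Definition PolyR : comNzRingType :=
  GRing.ComNzRing.clone {mpoly (Zrho p)[p.-1]} _.

Definition cst : {rmorphism Zrho p -> PolyR} :=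
  GRing.RMorphism.clone _ _ (@mpolyC p.-1 (Zrho p)) _.

Definition tauP : {rmorphism PolyR -> PolyR} :=
  GRing.RMorphism.clone _ _ (@map_mpoly p.-1 _ _ (tau0 D)) _.

Definition zP : PolyR := \sum_(i < p.-1) cst (rho p ^+ i) * 'X_i.

Definition CP : PolyR :=
  \prod_(i < p.-1) iter i tauP (1 + zP * cst (eta p ^+ p)).

Definition dtauP (w : PolyR) : PolyR := cst (delta ^+ p) * tauP w.

Definition normP (w : PolyR) : PolyR :=
  \big[fg_add (cst (eta p ^+ p))/0]_(i < p.-1)
    fg_muln (cst (eta p ^+ p)) (ns D ^ (p - 2 - i)) (iter i dtauP w).

Section Presentation.
Variables (R : comNzRingType) (loc : {rmorphism PolyR -> R}).

Definition hpoly : {poly R} :=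
  'X^p + map_poly (loc \o cst) gpoly - (loc (normP zP))%:P.

Lemma mk_monic_hpoly : prime p -> mk_monic hpoly = hpoly.
Proof.
move=> p_pr; have p1 := prime_gt1 p_pr.
set q := map_poly (loc \o cst) gpoly - (loc (normP zP))%:P.
have szq : (size q < size ('X^p : {poly R}))%N.
  rewrite size_polyXn ltnS (leq_trans (size_polyD _ _)) // geq_max size_polyN.
  rewrite (leq_trans (size_polyC_leq1 _)) ?(ltnW p1) // andbT.
  rewrite (leq_trans (size_poly _ _)) // (leq_trans (size_scale_leq _ _)) //.
  apply: (leq_trans (size_sum _ _ _)); apply/bigmax_leqP_seq => i.
  rewrite mem_index_iota => /andP[_ ip] _.
  by rewrite (leq_trans (size_scale_leq _ _)) // size_polyXn.
rewrite /mk_monic /hpoly -addrA -/q size_polyDl // monicE lead_coefDl //.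
by rewrite size_polyXn ltnS (ltnW p1) lead_coefXn eqxx.
Qed.

Definition Sring : comNzRingType := GRing.ComNzRing.clone {poly %/ hpoly} _.

Definition inc : {rmorphism R -> Sring} :=
  GRing.RMorphism.clone _ _ (qpolyC hpoly) _.

Definition theta : Sring := qpolyX hpoly.

Definition Scst (c : Zrho p) : Sring := inc (loc (cst c)).

End Presentation.

End PolyRing.

(* R, S, sigma and tau. R is given by an arbitrary localization map, and tau on
   R by its restriction to PolyR, which determines it. *)
Record generic_ext (p : nat) (D : cyclo_data p) := GenericExt {
  gR : comNzRingType;
  gloc : {rmorphism PolyR p -> gR};
  glocP : is_localization_at (CP D) gloc;
  gtauR : {rmorphism gR -> gR};
  gtauRE : forall f, gtauR (gloc f) = gloc (tauP D f);
  gsigma : {rmorphism Sring D gloc -> Sring D gloc};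
  gsigma_inc : forall a, gsigma (inc D gloc a) = inc D gloc a;
  gsigma_theta :
    gsigma (theta D gloc) = Scst D gloc (rho p) * theta D gloc + 1;
  gtau : {rmorphism Sring D gloc -> Sring D gloc};
  gtau_inc : forall a, gtau (inc D gloc a) = inc D gloc (gtauR a);
  (* tau theta = (1/delta) ((s * theta) (-) (r *_p z) eta^(p-1)) *)
  gtau_theta : is_fg_sub (Scst D gloc (eta p))
    (fg_muln (Scst D gloc (eta p)) (ns D) (theta D gloc))
    (fg_muln (Scst D gloc (eta p ^+ p)) (nr D) (inc D gloc (gloc (zP p)))
       * Scst D gloc (eta p ^+ p.-1))
    (Scst D gloc (delta D) * gtau (theta D gloc));
  gsigma_tau : forall x, gtau (gsigma x) = gsigma (gtau x) }.

Section Descent.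
Variables (p : nat) (D : cyclo_data p) (G : generic_ext D).

Definition Rtau : comPzRingType := fixed_ring (gtauR G).

Fact Stau_act_subproof (a : Rtau) :
  fixed_morph (@gsigma_tau p D G) (fixed_morph (@gtau_inc p D G) a)
  = fixed_morph (@gtau_inc p D G) a.
Proof. by apply: val_inj; rewrite /= gsigma_inc. Qed.

Definition Stau : cyclic_alg Rtau :=
  @CyclicAlg Rtau (fixed_ring (gtau G)) (fixed_morph (@gtau_inc p D G))
    (fixed_morph (@gsigma_tau p D G)) Stau_act_subproof.

End Descent.

(* Main.v *)
Require Import Defs.
From HB Require Import structures.
From mathcomp Require Import all_boot all_algebra.
From mathcomp Require Import ring.
From mathcomp.classical Require Import boolp.
From mathcomp.classical Require classical_sets.
From mathcomp.multinomials Require Import mpoly.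

Set Implicit Arguments.
Unset Strict Implicit.
Unset Printing Implicit Defensive.

Import GRing.Theory.
Local Open Scope ring_scope.

(* Extend scalars to [X = S1 (x) Z[rho]]. An element [y] of [S1] of trace 1 yields
   [x] in [X] with [sigma x = rho x + 1], so that [a = 1 + x eta] satisfies
   [sigma a = rho a]. Adding to [x] eigenvectors of [sigma] with eigenvalue [rho],
   one maximal ideal of [X^sigma] at a time, makes [a^p] avoid the finitely many
   maximal ideals that matter; its norm to [R1] is then a unit, hence so is [a].
   The twisted norm of (a multiple of) [x] for the law [(+)] is a generator [th1]
   satisfying all the relations imposed on [theta], with [x^p + g x] in the role
   of [z]. The coefficients of the latter specialize the variables [x_i], which
   gives equivariant maps [R -> X^sigma] and [S -> X]; since [X^tau = S1], they
   restrict to [R^tau -> R1] and [S^tau -> S1].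

   It remains to see that [S^tau/R^tau] is Galois, for then the induced morphism
   of Galois extensions is bijective. As [Z[rho]] is ramified at [p] this is not
   plain descent along [tau]: one shows that for [0 < k < p] the ideal of [S^tau]
   generated by the [sigma^k y - y] contains [p^2], by traces of multiples of
   [1 + theta eta], and also an element [1 + f] with [f] divisible by [eta] in [S],
   by the trace of [theta]; so this ideal is the unit ideal.

   Identities that would require dividing by [eta] are proved in polynomial rings
   over [Z[rho]], where [eta], a divisor of [p], is not a zero divisor. *)

(** * Units and maximal ideals *)

Section Units.
Variable A : comPzRingType.
Implicit Types x y : A.

Lemma is_unit1 : is_unit (1 : A).
Proof. by exists 1; rewrite mulr1. Qed.

Lemma is_unitM x y : is_unit x -> is_unit y -> is_unit (x * y).
Proof. by move=> [u xu] [v yv]; exists (u * v); rewrite mulrACA xu yv mulr1. Qed.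

Lemma is_unitMl x y : is_unit (x * y) -> is_unit x.
Proof. by move=> [u xyu]; exists (y * u); rewrite mulrA. Qed.

Lemma is_unitX x n : is_unit x -> is_unit (x ^+ n).
Proof.
move=> ux; elim: n => [|n IH]; first exact: is_unit1.
by rewrite exprS; apply: is_unitM.
Qed.

Lemma is_unitX_inv x n : (0 < n)%N -> is_unit (x ^+ n) -> is_unit x.
Proof. by case: n => // n _; rewrite exprS; apply: is_unitMl. Qed.

Lemma is_unit_prod (I : Type) (r : seq I) (P : pred I) (F : I -> A) :
  (forall i, P i -> is_unit (F i)) -> is_unit (\prod_(i <- r | P i) F i).
Proof. by move=> uF; apply: big_ind => //; [exact: is_unit1 | exact: is_unitM]. Qed.

Lemma is_unit_mulIr x y z : is_unit z -> x * z = y * z -> x = y.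
Proof.
by case=> w zw e; rewrite -[x]mulr1 -[y]mulr1 -zw !mulrA e.
Qed.

End Units.

Lemma rmorph_is_unit (A B : comPzRingType) (f : {rmorphism A -> B}) x :
  is_unit x -> is_unit (f x).
Proof. by case=> y xy; exists (f y); rewrite -rmorphM xy rmorph1. Qed.

Section Ideals.
Variable A : comPzRingType.

Section Ideal.
Variables (I : A -> Prop) (idI : is_ideal I).

Lemma ideal0 : I 0. Proof. by case: idI. Qed.

Lemma idealD x y : I x -> I y -> I (x + y). Proof. by case: idI => _ D _; apply: D. Qed.

Lemma ideal_mull a x : I x -> I (a * x). Proof. by case: idI => _ _; apply. Qed.

Lemma ideal_mulr a x : I x -> I (x * a). Proof. by rewrite mulrC; apply: ideal_mull. Qed.

Lemma idealN x : I x -> I (- x). Proof. by rewrite -mulN1r; apply: ideal_mull. Qed.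

Lemma idealB x y : I x -> I y -> I (x - y).
Proof. by move=> Ix Iy; apply: idealD => //; apply: idealN. Qed.

Lemma ideal_sum (T : Type) (r : seq T) (P : pred T) (F : T -> A) :
  (forall i, P i -> I (F i)) -> I (\sum_(i <- r | P i) F i).
Proof. by move=> IF; apply: big_ind => //; [exact: ideal0 | exact: idealD]. Qed.

End Ideal.

(** Zorn's lemma on the proper ideals containing [I]: the union of a nonempty chain of them is again
    one. *)
Lemma maximal_ideal_above (I : A -> Prop) : is_ideal I -> ~ I 1 ->
  exists M, is_maximal_ideal M /\ forall x, I x -> M x.
Proof.
move=> idI I1.
pose Q (J : A -> Prop) := [/\ is_ideal J, ~ J 1 & forall x, I x -> J x].
pose T := {J : A -> Prop | Q J}.
pose t0 : T := exist Q I (And3 idI I1 (fun x Ix => Ix)).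
pose sub (J K : T) := `[< forall x, sval J x -> sval K x >].
have [|||M maxM] := @classical_sets.ZL_preorder T t0 sub.
- by move=> J; apply/asboolP.
- by move=> J K L /asboolP KJ /asboolP JL; apply/asboolP => x /KJ /JL.
- move=> C totC; have [[J0 CJ0]|C0] := pselect (exists J, C J); last first.
    by exists t0 => J CJ; case: C0; exists J.
  pose U x := exists2 J : T, C J & sval J x.
  have idU : is_ideal U.
    split.
    - by exists J0 => //; case: (svalP J0) => /ideal0.
    - move=> x y [J CJ Jx] [K CK Ky].
      have [/asboolP JK|/asboolP KJ] := totC _ _ CJ CK.
        by exists K => //; case: (svalP K) => idK _ _; apply: idealD => //; apply: JK.
      by exists J => //; case: (svalP J) => idJ _ _; apply: idealD => //; apply: KJ.
    - by move=> a x [J CJ Jx]; exists J => //; case: (svalP J) => idJ _ _; apply: ideal_mull.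
  have QU : Q U.
    split=> //; first by case=> J _; case: (svalP J).
    by move=> x Ix; exists J0 => //; case: (svalP J0) => _ _; apply.
  by exists (exist Q U QU) => J CJ; apply/asboolP => x Jx; exists J.
have [idM M1 IM] := svalP M.
exists (sval M); split=> //; split=> // J idJ J1 MJ x Jx.
have QJ : Q J by split=> // y /IM; apply: MJ.
have /asboolP := maxM (exist Q J QJ) (asboolT MJ).
exact.
Qed.

Lemma is_unit_maximal (x : A) :
  (forall M, is_maximal_ideal M -> ~ M x) -> is_unit x.
Proof.
move=> xM; apply: contrapT => xU.
pose I y := exists a, y = x * a.
have idI : is_ideal I.
  split; first by exists 0; rewrite mulr0.
    by move=> y z [a ->] [b ->]; exists (a + b); rewrite mulrDr.
  by move=> c y [a ->]; exists (c * a); rewrite mulrCA.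
have [|M [maxM IM]] := maximal_ideal_above idI.
  by case=> a e; apply: xU; exists a.
by apply: (xM M maxM); apply: IM; exists 1; rewrite mulr1.
Qed.

Section Maximal.
Variables (M : A -> Prop) (maxM : is_maximal_ideal M).

Lemma maximal_is_ideal : is_ideal M. Proof. by case: maxM. Qed.
Let idM := maximal_is_ideal.

Lemma maximal_comaximal (J : A -> Prop) x : is_ideal J -> J x -> ~ M x ->
  exists2 m, M m & J (1 - m).
Proof.
move=> idJ Jx Mx; pose K y := exists2 m, M m & J (y - m).
have idK : is_ideal K.
  split.
  - by exists 0; [exact: ideal0 | rewrite subrr; exact: ideal0].
  - move=> y z [m Mm Jy] [n Mn Jz]; exists (m + n); first exact: idealD.
    by rewrite opprD addrACA; apply: idealD.
  - move=> a y [m Mm Jy]; exists (a * m); first exact: ideal_mull.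
    by rewrite -mulrBr; apply: ideal_mull.
have MK y : M y -> K y by exists y => //; rewrite subrr; apply: ideal0.
have [//|K1] := pselect (K 1).
case: maxM => _ _ /(_ K idK K1 MK) KM; case: Mx; apply: KM.
by exists 0; [exact: ideal0 | rewrite subr0].
Qed.

Lemma maximal_mul x y : M (x * y) -> M x \/ M y.
Proof.
move=> Mxy; have [Mx|Mx] := pselect (M x); [by left | right].
pose J z := exists a, z = x * a.
have idJ : is_ideal J.
  split; first by exists 0; rewrite mulr0.
    by move=> u v [a ->] [b ->]; exists (a + b); rewrite mulrDr.
  by move=> c u [a ->]; exists (c * a); rewrite mulrCA.
have Jx : J x by exists 1; rewrite mulr1.
have [m Mm [a e]] := maximal_comaximal idJ Jx Mx.
have -> : y = y * m + a * (x * y).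
  by rewrite [a * _]mulrCA [x * _]mulrA -e mulrBl mul1r [y * m]mulrC mulrC addrC -mulrC subrK.
by apply: idealD => //; apply: ideal_mull.
Qed.

Lemma maximal_exp x n : M (x ^+ n) -> M x.
Proof.
elim: n => [|n IH]; first by rewrite expr0 => M1; case: maxM => _ /(_ M1).
by rewrite exprS => /maximal_mul[|/IH].
Qed.

Lemma maximal_prod (I : Type) (r : seq I) (P : pred I) (F : I -> A) :
  (forall i, P i -> ~ M (F i)) -> ~ M (\prod_(i <- r | P i) F i).
Proof.
move=> MF; apply: (big_ind (fun z => ~ M z)) => //; first by case: maxM.
by move=> x y Mx My /maximal_mul[].
Qed.

End Maximal.

End Ideals.

(** The section [g] makes [f] surjective, so an ideal [J] strictly above the preimage maps onto an
    ideal not contained in [M], hence comaximal with it. *)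
Lemma maximal_preim (A B : comPzRingType) (f : {rmorphism A -> B}) g M :
  cancel g f -> is_maximal_ideal M -> is_maximal_ideal (fun x => M (f x)).
Proof.
move=> gK maxM; have idM := maximal_is_ideal maxM; split.
- split; first by rewrite rmorph0; apply: ideal0.
    by move=> x y Mx My; rewrite rmorphD; apply: idealD.
  by move=> a x Mx; rewrite rmorphM; apply: ideal_mull.
- by rewrite rmorph1; case: maxM.
- move=> J idJ J1 MJ x Jx; apply: contrapT => Mx.
  have idK : is_ideal (fun y => exists2 z, J z & f z = y).
    split; first by exists 0; [exact: ideal0 | exact: rmorph0].
      by move=> _ _ [u Ju <-] [v Jv <-]; exists (u + v); [exact: idealD | exact: rmorphD].
    by move=> a _ [u Ju <-]; exists (g a * u); [exact: ideal_mull | rewrite rmorphM gK].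
  have [|m Mm [z Jz fz]] := maximal_comaximal maxM idK _ Mx; first by exists x.
  apply: J1; have -> : 1 = z + (1 - z) by rewrite addrC subrK.
  by apply: idealD => //; apply: MJ; rewrite rmorphB rmorph1 fz subKr.
Qed.

(** * The formal group law [x + y + x y e] *)

Section FormalGroup.
Variables (A : comPzRingType) (e : A).
Implicit Types x y z : A.
Local Notation fadd := (fg_add e).

Lemma fg_addA : associative fadd.
Proof. by move=> x y z; rewrite /fg_add; ring. Qed.

Lemma fg_addC : commutative fadd.
Proof. by move=> x y; rewrite /fg_add; ring. Qed.

Lemma fg_add0 : left_id 0 fadd.
Proof. by move=> x; rewrite /fg_add; ring. Qed.

HB.instance Definition _ := Monoid.isComLaw.Build A 0 (fg_add e)
  fg_addA fg_addC fg_add0.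

Lemma fg_mulnS n x : fg_muln e n.+1 x = fadd x (fg_muln e n x).
Proof. by []. Qed.

Lemma fg_muln1 x : fg_muln e 1 x = x.
Proof. by rewrite /fg_muln /= fg_addC fg_add0. Qed.

Lemma fg_mulnD m n x : fg_muln e (m + n) x = fadd (fg_muln e m x) (fg_muln e n x).
Proof.
elim: m => [|m IH]; first by rewrite add0n fg_add0.
by rewrite addSn !fg_mulnS IH fg_addA.
Qed.

Lemma fg_mulnA m n x : fg_muln e (m * n) x = fg_muln e m (fg_muln e n x).
Proof.
elim: m => [|m IH]; first by rewrite mul0n.
by rewrite mulSn fg_mulnS fg_mulnD IH.
Qed.

Lemma fg_muln_add n x y : fg_muln e n (fadd x y) = fadd (fg_muln e n x) (fg_muln e n y).
Proof.
elim: n => [|n IH]; first by rewrite fg_add0.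
by rewrite !fg_mulnS IH (Monoid.mulmACA (fg_add e)).
Qed.

Lemma fg_mulnx0 n : fg_muln e n 0 = 0.
Proof. by elim: n => // n IH; rewrite fg_mulnS IH fg_add0. Qed.

Lemma fg_muln_sum (I : Type) (r : seq I) (P : pred I) (F : I -> A) n :
  fg_muln e n (\big[fadd/0]_(i <- r | P i) F i)
  = \big[fadd/0]_(i <- r | P i) fg_muln e n (F i).
Proof.
by rewrite (big_morph (fg_muln e n) (fg_muln_add n) (fg_mulnx0 n)).
Qed.

(** Where [e] is not a zero divisor, this reduces every identity of the law to one between
    products. *)
Lemma one_fg_add x y : 1 + fadd x y * e = (1 + x * e) * (1 + y * e).
Proof. by rewrite /fg_add; ring. Qed.

Lemma one_fg_muln n x : 1 + fg_muln e n x * e = (1 + x * e) ^+ n.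
Proof.
elim: n => [|n IH]; first by rewrite /fg_muln /= mul0r addr0.
by rewrite fg_mulnS one_fg_add IH exprS.
Qed.

Lemma one_fg_sum (I : Type) (r : seq I) (P : pred I) (F : I -> A) :
  1 + (\big[fadd/0]_(i <- r | P i) F i) * e = \prod_(i <- r | P i) (1 + F i * e).
Proof.
rewrite (big_morph (fun x => 1 + x * e) one_fg_add (_ : _ = 1)) //.
by rewrite mul0r addr0.
Qed.

Lemma fg_addIr z x y : is_unit (1 + z * e) -> fadd x z = fadd y z -> x = y.
Proof.
move=> uz E; apply: (is_unit_mulIr uz).
have -> : x * (1 + z * e) = fg_add e x z - z by rewrite /fg_add; ring.
by rewrite E /fg_add; ring.
Qed.

End FormalGroup.

Section FormalGroupMorph.
Variables (A B : comPzRingType) (f : {rmorphism A -> B}).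

Lemma rmorph_fg_add e x y : f (fg_add e x y) = fg_add (f e) (f x) (f y).
Proof. by rewrite /fg_add !rmorphD !rmorphM. Qed.

Lemma rmorph_fg_muln e n x : f (fg_muln e n x) = fg_muln (f e) n (f x).
Proof.
elim: n => [|n IH]; first by rewrite rmorph0.
by rewrite !fg_mulnS rmorph_fg_add IH.
Qed.

Lemma rmorph_fg_sum e (I : Type) (r : seq I) (P : pred I) (F : I -> A) :
  f (\big[fg_add e/0]_(i <- r | P i) F i)
  = \big[fg_add (f e)/0]_(i <- r | P i) f (F i).
Proof. exact: (big_morph f (rmorph_fg_add e) (rmorph0 f)). Qed.

End FormalGroupMorph.

Section FormalGroupScale.
Variables (A : comPzRingType) (c e : A).

Lemma fg_scale_add x y : c * fg_add (c * e) x y = fg_add e (c * x) (c * y).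
Proof. by rewrite /fg_add; ring. Qed.

Lemma fg_scale_muln n x : c * fg_muln (c * e) n x = fg_muln e n (c * x).
Proof.
elim: n => [|n IH]; first by rewrite mulr0.
by rewrite !fg_mulnS fg_scale_add IH.
Qed.

Lemma fg_scale_sum (I : Type) (r : seq I) (P : pred I) (F : I -> A) :
  c * (\big[fg_add (c * e)/0]_(i <- r | P i) F i)
  = \big[fg_add e/0]_(i <- r | P i) (c * F i).
Proof. exact: (big_morph ( *%R c) fg_scale_add (mulr0 c)). Qed.

End FormalGroupScale.

(** * Tensor products and Galois extensions *)

Lemma rmorphism_of (A B : comPzRingType) (F : A -> B) :
  F 1 = 1 -> (forall x y, F (x + y) = F x + F y) ->
  (forall x y, F (x * y) = F x * F y) ->
  exists f : {rmorphism A -> B}, forall x, f x = F x.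
Proof.
move=> F1 FD FM.
have Fz : zmod_morphism F by move=> x y; apply/eqP; rewrite eq_sym subr_eq -FD subrK.
have Fm : monoid_morphism F by split.
pose f : {rmorphism A -> B} := HB.pack F (GRing.isZmodMorphism.Build A B F Fz)
  (GRing.isMonoidMorphism.Build A B F Fm).
by exists f.
Qed.

Section IterMorph.
Variables (A : comPzRingType) (f : {rmorphism A -> A}) (k : nat).

Fact iter_is_zmod_morphism : zmod_morphism (iter k f).
Proof. by move=> x y; elim: k => // n /= ->; rewrite rmorphB. Qed.

Fact iter_is_monoid_morphism : monoid_morphism (iter k f).
Proof.
by split=> [|x y]; elim: k => //= n ->; rewrite ?rmorph1 ?rmorphM.
Qed.

HB.instance Definition _ :=
  GRing.isZmodMorphism.Build A A (iter k f) iter_is_zmod_morphism.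
HB.instance Definition _ :=
  GRing.isMonoidMorphism.Build A A (iter k f) iter_is_monoid_morphism.

End IterMorph.

Lemma iter_commute (A B : Type) (f : A -> A) (g : B -> B) (h : A -> B) k :
  (forall x, g (h x) = h (f x)) -> forall x, iter k g (h x) = h (iter k f x).
Proof. by move=> gh x; elim: k => //= k ->; rewrite gh. Qed.

Section TensorUniversal.
Variables (A B C : comPzRingType).
Variables (f : {rmorphism A -> B}) (g : {rmorphism A -> C}).
Local Notation T := (tensor f g).
Local Notation pure := (pure f g).

Lemma pureDl b b' c : pure (b + b') c = pure b c + pure b' c.
Proof. by rewrite tens_piD; apply/tens_piP; apply: tens_Dl. Qed.

Lemma pureDr b c c' : pure b (c + c') = pure b c + pure b c'.
Proof. by rewrite tens_piD; apply/tens_piP; apply: tens_Dr. Qed.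

Lemma pure_bal b a c : pure (b * f a) c = pure b (g a * c).
Proof. by apply/tens_piP; apply: tens_bal. Qed.

Lemma pureM b c b' c' : pure b c * pure b' c' = pure (b * b') (c * c').
Proof. by rewrite tens_piM. Qed.

Lemma pure0l c : pure 0 c = 0.
Proof. by apply/tens_piP; apply: tens_0l. Qed.

Lemma pure_suml (I : Type) (r : seq I) (F : I -> B) c :
  \sum_(i <- r) pure (F i) c = pure (\sum_(i <- r) F i) c.
Proof.
by rewrite (big_morph (fun b => pure b c) (fun x y => pureDl x y c) (pure0l c)).
Qed.

Lemma tens_pi_sum s : tens_pi f g s = \sum_(x <- s) pure x.1 x.2.
Proof.
elim: s => [|[b c] s IH]; first by rewrite big_nil.
by rewrite big_cons -IH tens_piD.
Qed.

Lemma tens_ind (P : T -> Prop) :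
  P 0 -> (forall x y, P x -> P y -> P (x + y)) -> (forall b c, P (pure b c)) ->
  forall x, P x.
Proof.
move=> P0 PD Pp x; rewrite -[x]tens_pi_repr tens_pi_sum.
by apply: big_ind => // y _; apply: Pp.
Qed.

(** Summing [phi] over a list of pairs respects each generator of [tens_rel]. *)
Lemma tens_lift (V : zmodType) (phi : B -> C -> V) :
  (forall b b' c, phi (b + b') c = phi b c + phi b' c) ->
  (forall b c c', phi b (c + c') = phi b c + phi b c') ->
  (forall b a c, phi (b * f a) c = phi b (g a * c)) ->
  exists F : T -> V, (forall x y, F (x + y) = F x + F y) /\
    forall b c, F (pure b c) = phi b c.
Proof.
move=> phiDl phiDr phib; pose S s := \sum_(x <- s) phi x.1 x.2.
have phi0 c : phi 0 c = 0 by apply: (addrI (phi 0 c)); rewrite -phiDl !addr0.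
have SP s t : tens_rel f g s t -> S s = S t.
  elim=> {s t} [s|s t _ ->|s t u _ -> _ ->|s t s' t' _ IH _ IH'|s t|c|b b' c
    |b c c'|a b c] //; rewrite /S.
  - by rewrite !big_cat -/(S s) -/(S s') IH IH'.
  - by rewrite !big_cat /= addrC.
  - by rewrite big_cons big_nil phi0 addr0.
  - by rewrite !big_cons big_nil phiDl !addr0.
  - by rewrite !big_cons big_nil phiDr !addr0.
  - by rewrite !big_cons phib.
have Spi s : S (repr (tens_pi f g s)) = S s by apply/SP/tens_repr.
exists (fun x => S (repr x)); split; last by move=> b c; rewrite Spi /S big_seq1.
move=> x y; rewrite -{1}[x]tens_pi_repr -{1}[y]tens_pi_repr tens_piD Spi.
by rewrite /S big_cat.
Qed.

Lemma tens_rlift (E : comPzRingType) (u : {rmorphism B -> E})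
    (v : {rmorphism C -> E}) :
  (forall a, u (f a) = v (g a)) ->
  exists F : {rmorphism T -> E}, forall b c, F (pure b c) = u b * v c.
Proof.
move=> uv; have [|||F [FD Fp]] := @tens_lift E (fun b c => u b * v c).
- by move=> b b' c; rewrite rmorphD mulrDl.
- by move=> b c c'; rewrite rmorphD mulrDr.
- by move=> b a c; rewrite !rmorphM uv mulrA.
have F0 : F 0 = 0 by apply: (addrI (F 0)); rewrite -FD !addr0.
have [|||G GF] := @rmorphism_of T E F; last 1 first.
- by exists G => b c; rewrite GF Fp.
- by rewrite Fp !rmorph1 mulr1.
- exact: FD.
elim/tens_ind => [y|x x' IH IH' y|b c]; first by rewrite mul0r F0 mul0r.
  by rewrite mulrDl !FD mulrDl IH IH'.
elim/tens_ind => [|x x' IH IH'|b' c']; first by rewrite mulr0 F0 mulr0.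
  by rewrite mulrDr !FD mulrDr IH IH'.
by rewrite pureM !Fp !rmorphM mulrACA.
Qed.

Lemma tens_inl_rmorphism : exists i : {rmorphism B -> T}, forall b, i b = pure b 1.
Proof.
apply: rmorphism_of => // [b b'|b b']; first exact: pureDl.
by rewrite pureM mulr1.
Qed.

End TensorUniversal.

Lemma tens_mapl_pure (A B C : comPzRingType) (f : {rmorphism A -> B})
    (g : {rmorphism A -> C}) (s : {rmorphism B -> B})
    (sf : forall a, s (f a) = f a) b c :
  tens_mapl g sf (pure f g b c) = pure f g (s b) c.
Proof. exact: tens_mapl_pi. Qed.

Lemma big_nth_ord (A : nmodType) (T : Type) (x0 : T) (w : seq T) (F : T -> A) :
  \sum_(x <- w) F x = \sum_(i < size w) F (nth x0 w i).
Proof. by rewrite (big_nth x0) big_mkord. Qed.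

(** * Traces and dual families of cyclic Galois extensions *)

Section Galois.
Variables (p : nat) (p_gt0 : (0 < p)%N).

Section Trace.
Variables (A : comPzRingType) (s : {rmorphism A -> A}).
Implicit Types x y : A.

Definition ctrace x := \sum_(k < p) iter k s x.

Lemma ctraceD x y : ctrace (x + y) = ctrace x + ctrace y.
Proof. by rewrite -big_split; apply: eq_bigr => k _; rewrite rmorphD. Qed.

Lemma ctraceZ a x : s a = a -> ctrace (a * x) = a * ctrace x.
Proof.
move=> sa; rewrite mulr_sumr; apply: eq_bigr => k _; rewrite rmorphM; congr (_ * _).
by elim: (k : nat) => //= n ->.
Qed.

Lemma ctrace_fix x : iter p s x = x -> s (ctrace x) = ctrace x.
Proof.
move=> spx; rewrite /ctrace rmorph_sum /=.
case: p p_gt0 spx => // n _ spx; rewrite big_ord_recr big_ord_recl /= addrC.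
by congr (_ + _); rewrite -iterS spx.
Qed.

Definition dual_family (w : seq (A * A)) := forall k, (k < p)%N ->
  \sum_(xy <- w) xy.1 * iter k s xy.2 = (k == 0)%:R.

(** After exchanging the sums, the coefficient of [iter k s x] is the [k]-th dual relation, so only
    [k = 0] contributes. The second members thus give coordinates by traces. *)
Lemma dual_family_expand w x : dual_family w ->
  \sum_(xy <- w) xy.1 * ctrace (xy.2 * x) = x.
Proof.
move=> dw; transitivity (\sum_(k < p) (\sum_(xy <- w) xy.1 * iter k s xy.2) * iter k s x).
  transitivity (\sum_(xy <- w) \sum_(k < p) xy.1 * iter k s xy.2 * iter k s x).
    apply: eq_bigr => xy _; rewrite mulr_sumr; apply: eq_bigr => k _.
    by rewrite rmorphM mulrA.
  by rewrite exchange_big; apply: eq_bigr => k _; rewrite mulr_suml.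
have /= d0 := dw 0%N p_gt0.
rewrite (bigD1 (Ordinal p_gt0)) //= d0 mul1r big1 ?addr0 //= => k k0.
rewrite dw // (_ : (k == 0 :> nat) = false) ?mul0r //.
by apply: negbTE; apply: contraNneq k0 => k0; apply/eqP/val_inj.
Qed.

End Trace.

(** Leibniz expansion, with products compared factor by factor. *)
Lemma det_congr (A : comPzRingType) (I : A -> Prop) n (M N : 'M[A]_n) :
  is_ideal I -> (forall i j, I (M i j - N i j)) -> I (\det M - \det N).
Proof.
move=> idI MN; rewrite /determinant -sumrB; apply: ideal_sum => // s _.
rewrite -mulrBr; apply: ideal_mull => //.
apply: (big_ind2 (fun x y => I (x - y))) => [|a b c d ab cd|i _].
- by rewrite subrr; apply: ideal0.
- have -> : a * c - b * d = c * (a - b) + b * (c - d) by ring.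
  by apply: idealD => //; apply: ideal_mull.
- exact: MN.
Qed.

Section TraceOne.
Variables (A : comPzRingType) (E : cyclic_alg A) (galE : is_Galois p E).
Local Notation s := (ca_act E).
Local Notation i := (ca_struct E).

Lemma Galois_ctrace (x : E) : exists a, ctrace s x = i a.
Proof. by case: galE => sp _ fixE _; apply/fixE/ctrace_fix. Qed.

(* The traces of the products of the two halves of a dual family form a matrix
   [T] fixing the row of its first members, so [\det (1 - T) = 0]; but this
   determinant is 1 modulo the ideal of traces. *)
Lemma Galois_trace_one : exists y : E, ctrace s y = 1.
Proof.
have [sp inji fixE [w dw]] := galE.
pose I a := exists x : E, ctrace s x = i a.
have idI : is_ideal I.
  split.
  - by exists 0; rewrite rmorph0 /ctrace big1 // => k _; rewrite rmorph0.
  - by move=> a b [x xa] [y yb]; exists (x + y); rewrite ctraceD xa yb rmorphD.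
  - by move=> a b [x xb]; exists (i a * x); rewrite ctraceZ ?ca_act_struct // xb rmorphM.
pose n := size w; pose x k : E := (nth 0 w k).1; pose y k : E := (nth 0 w k).2.
have [t tE] : exists t : 'I_n * 'I_n -> A, forall kl : 'I_n * 'I_n,
    ctrace s (y kl.1 * x kl.2) = i (t kl).
  have [|t tE] := @choice _ _ (fun (kl : 'I_n * 'I_n) a => ctrace s (y kl.1 * x kl.2) = i a).
    by move=> kl; apply: Galois_ctrace.
  by exists t.
pose M : 'M[A]_n := \matrix_(k, l) ((k == l)%:R - t (k, l)).
pose X : 'rV[E]_n := \row_k x k.
have XM : X *m map_mx i M = 0.
  apply/rowP => l; rewrite !mxE.
  have := dual_family_expand (x l) dw; rewrite (big_nth_ord (0, 0)) => e.
  under eq_bigr => k _ do rewrite !mxE rmorphB rmorph_nat mulrBr -tE /=.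
  rewrite sumrB -[X in _ - X]/(\sum_(k < size w) x k * ctrace s (y k * x l)) e.
  rewrite (bigD1 l) //= eqxx mulr1 big1 ?addr0 ?subrr // => k /negPf ->.
  by rewrite mulr0.
(* The adjugate turns [X M = 0] into [det M] killing every [x k]; these generate the unit ideal,
   whence [det M = 0]. *)
have detx (k : 'I_n) : x k * i (\det M) = 0.
  have /(congr1 (fun Y => Y *m \adj (map_mx i M))) := XM.
  rewrite -mulmxA mul_mx_adj det_map_mx mul0mx mul_mx_scalar => /rowP/(_ k).
  by rewrite !mxE mulrC.
have det0 : \det M = 0.
  apply: inji; rewrite rmorph0 -[i _]mul1r.
  have /= d0 := dw 0%N p_gt0; rewrite -[1]/(1%:R) -d0 (big_nth_ord (0, 0)).
  by rewrite mulr_suml big1 // => k _; rewrite mulrAC detx mul0r.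
have := @det_congr A I n 1%:M M idI; rewrite det0 det1 subr0.
case=> [k l|y0 y0E]; last by exists y0; rewrite y0E rmorph1.
rewrite !mxE opprB addrC subrK .
by exists (y k * x l); rewrite -tE.
Qed.

End TraceOne.

(* A morphism of cyclic Galois extensions is an isomorphism: the image of a dual
   family is a dual family, and expanding along both gives the inverse. *)
Lemma Galois_base_change_iso (A B : comPzRingType) (E : cyclic_alg A)
    (F : cyclic_alg B) (psi : {rmorphism A -> B}) (phi : {rmorphism E -> F}) :
  is_Galois p E -> is_Galois p F ->
  (forall a, phi (ca_struct E a) = ca_struct F (psi a)) ->
  (forall x, phi (ca_act E x) = ca_act F (phi x)) ->
  cyclic_alg_iso F (base_change E psi).
Proof.
move=> galE galF phistr phiact.
have [_ _ _ [w dw]] := galE; have [_ injF _ _] := galF.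
have phiact' x : ca_act F (phi x) = phi (ca_act E x) by [].
have phitr x : ctrace (ca_act F) (phi x) = phi (ctrace (ca_act E) x).
  by rewrite rmorph_sum; apply: eq_bigr => k _; rewrite (iter_commute k phiact').
pose w' := [seq (phi xy.1, phi xy.2) | xy <- w].
have dw' : dual_family (ca_act F) w'.
  move=> k kp; rewrite big_map -(rmorph_nat phi) -(dw k kp) rmorph_sum.
  by apply: eq_bigr => xy _; rewrite rmorphM (iter_commute k phiact').
have [r rE] : exists r : F -> B, forall x, ctrace (ca_act F) x = ca_struct F (r x).
  have [|r rE] := @choice _ _ (fun x a => ctrace (ca_act F) x = ca_struct F a).
    exact: Galois_ctrace.
  by exists r.
have rD x y : r (x + y) = r x + r y.
  by apply: injF; rewrite rmorphD -!rE ctraceD.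
pose T := base_change E psi.
pose h (x : F) : T := \sum_(xy <- w) pure (ca_struct E) psi xy.1 (r (phi xy.2 * x)).
have hD x y : h (x + y) = h x + h y.
  by rewrite -big_split; apply: eq_bigr => xy _; rewrite mulrDr rD pureDr.
have [g gE] := @tens_rlift _ _ _ (ca_struct E) psi F phi (ca_struct F) phistr.
have hK : cancel h g.
  move=> x; rewrite rmorph_sum -[RHS](dual_family_expand x dw') big_map.
  by apply: eq_bigr => xy _; rewrite gE rE.
have gK : cancel g h.
  elim/tens_ind => [|x y hx hy|b c]; last 1 first.
  - rewrite gE -[b in RHS](dual_family_expand b dw) -pure_suml.
    apply: eq_bigr => xy _; have [a aE] := Galois_ctrace galE (xy.2 * b).
    rewrite aE pure_bal; congr pure; apply: injF.
    rewrite mulrA -rmorphM -rE mulrC ctraceZ ?ca_act_struct // phitr aE phistr.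
    by rewrite rmorphM mulrC.
  - rewrite rmorph0; apply: (addrI (h 0)); by rewrite -hD !addr0.
  - by rewrite rmorphD hD hx hy.
have injg : injective g by apply: can_inj gK.
(* [h] inherits the ring laws from the ring morphism [g], whose inverse it is. *)
have [|||f fE] := @rmorphism_of F T h.
- by apply: injg; rewrite hK rmorph1.
- exact: hD.
- by move=> x y; apply: injg; rewrite rmorphM !hK.
exists f; split.
- by exists g => x; rewrite fE ?hK ?gK.
- by move=> a; rewrite fE; apply: injg; rewrite hK gE rmorph1 mul1r.
- move=> x; rewrite !fE; apply: injg; rewrite hK -[x in LHS]hK.
  elim/tens_ind: (h x) => [|y z IHy IHz|b c]; first by rewrite !rmorph0.
    by rewrite !rmorphD IHy IHz.
  by rewrite [ca_act T _]tens_mapl_pure !gE rmorphM phiact ca_act_struct.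
Qed.

End Galois.

(** * Universal properties *)

(** The targets of the lifts below may be the zero ring: that case is trivial, and otherwise
    evaluation takes place in the nonzero copy provided here. *)
Lemma nontrivial_comNzRing (A : comPzRingType) : (1 : A) != 0 ->
  exists (B : comNzRingType) (f : {rmorphism A -> B}) (g : {rmorphism B -> A}),
    cancel g f /\ cancel f g.
Proof.
move=> nz.
pose B : comNzRingType :=
  HB.pack (GRing.ComPzRing.sort A) (GRing.PzSemiRing_isNonZero.Build _ nz).
have [|||f fE] := @rmorphism_of A B (fun x => x) => //.
have [|||g gE] := @rmorphism_of B A (fun x => x) => //.
by exists B, f, g; split=> x; rewrite fE gE.
Qed.

Lemma trivial_rmorphism (A B : comPzRingType) :
  (1 : B) = 0 -> (forall x y : B, x = y) /\ exists f : {rmorphism A -> B}, True.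
Proof.
move=> B0; have triv (x y : B) : x = y by rewrite -[x]mul1r -[y]mul1r B0 !mul0r.
by split=> //; have [|||f _] := @rmorphism_of A B (fun=> 0); last by exists f.
Qed.

Lemma poly_lift (R : comNzRingType) (B : comPzRingType) (f : {rmorphism R -> B}) b :
  exists F : {rmorphism {poly R} -> B}, (forall c, F c%:P = f c) /\ F 'X = b.
Proof.
have [/(@trivial_rmorphism {poly R})[triv [F _]]|nz] := eqVneq (1 : B) 0.
  by exists F; split.
have [B' [u [v [vK uK]]]] := nontrivial_comNzRing nz.
have cfb : commr_rmorph (u \o f) (u b) by move=> x; apply: mulrC.
exists (GRing.RMorphism.clone _ _ (v \o horner_morph cfb) _); split=> [c|] /=.
  by rewrite horner_morphC /= uK.
by rewrite horner_morphX uK.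
Qed.

Lemma mpoly_lift n (R : comNzRingType) (B : comPzRingType) (f : {rmorphism R -> B})
    (b : 'I_n -> B) :
  exists F : {rmorphism {mpoly R[n]} -> B},
    (forall c, F c%:MP = f c) /\ forall i, F 'X_i = b i.
Proof.
have [/(@trivial_rmorphism {mpoly R[n]})[triv [F _]]|nz] := eqVneq (1 : B) 0.
  by exists F; split.
have [B' [u [v [vK uK]]]] := nontrivial_comNzRing nz.
exists (GRing.RMorphism.clone _ _ (v \o mmap (u \o f) (u \o b)) _).
by split=> [c|i] /=; rewrite ?mmapC ?mmapX ?mmap1U /= uK.
Qed.

Lemma mpoly_ext n (R : comNzRingType) (B : comPzRingType)
    (F G : {rmorphism {mpoly R[n]} -> B}) :
  (forall c, F c%:MP = G c%:MP) -> (forall i, F 'X_i = G 'X_i) -> F =1 G.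
Proof.
move=> FGC FGX q; rewrite (mpolyE q) !rmorph_sum; apply: eq_bigr => m _.
rewrite -mul_mpolyC !rmorphM FGC mpolyXE_id !rmorph_prod; congr (_ * _).
by apply: eq_bigr => i _; rewrite !rmorphXn FGX.
Qed.

Import Pdiv.Ring Pdiv.RingMonic.

Section Qpoly.
Variables (R : comNzRingType) (h : {poly R}) (hm : mk_monic h = h).
Local Notation Q := {poly %/ h}.

Lemma in_qpolyK (x : Q) : in_qpoly h x = x.
Proof. by apply: val_inj; rewrite /= rmodp_small // size_mk_monic. Qed.

Lemma in_qpolyC c : in_qpoly h c%:P = qpolyC h c.
Proof. by rewrite -[RHS]in_qpolyK. Qed.

Lemma in_qpoly_mod : in_qpoly h h = 0.
Proof. by apply: val_inj; rewrite /= hm rmodpp // -hm monic_mk_monic. Qed.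

Lemma qpoly_expand (x : Q) :
  x = \sum_(i < size (x : {poly R})) qpolyC h (x : {poly R})`_i * qpolyX h ^+ i.
Proof.
rewrite -[LHS]in_qpolyK -{1}[x : {poly R}]coefK poly_def rmorph_sum.
by apply: eq_bigr => i _; rewrite -mul_polyC rmorphM rmorphXn /= in_qpolyC.
Qed.

Lemma qpoly_ext (B : comPzRingType) (F G : {rmorphism Q -> B}) :
  (forall c, F (qpolyC h c) = G (qpolyC h c)) -> F (qpolyX h) = G (qpolyX h) ->
  F =1 G.
Proof.
move=> FGC FGX x; rewrite [x]qpoly_expand !rmorph_sum; apply: eq_bigr => i _.
by rewrite !rmorphM !rmorphXn FGC FGX.
Qed.

Lemma qpoly_lift (B : comPzRingType) (f : {rmorphism R -> B}) b :
  (forall F : {rmorphism {poly R} -> B},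
     (forall c, F c%:P = f c) -> F 'X = b -> F h = 0) ->
  exists F : {rmorphism Q -> B},
    (forall c, F (qpolyC h c) = f c) /\ F (qpolyX h) = b.
Proof.
move=> hF; have [F [FC FX]] := poly_lift f b; have Fh := hF F FC FX.
(* Since [F h = 0], [F] does not see the reduction modulo [h], and so is multiplicative on reduced
   representatives. *)
have Fmod q : F (in_qpoly h q) = F q.
  have -> : F q = F (rdivp q (mk_monic h) * mk_monic h + rmodp q (mk_monic h)).
    by rewrite -(rdivp_eq (monic_mk_monic h) q).
  by rewrite rmorphD rmorphM (_ : F (mk_monic h) = 0) ?hm // mulr0 add0r.
have [|||G GE] := @rmorphism_of Q B (fun x => F x).
- by rewrite -[RHS](rmorph1 F).
- by move=> x y; rewrite -rmorphD.
- move=> x y; exact: etrans (Fmod ((x : {poly R}) * y)) (rmorphM F _ _).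
by exists G; split=> [c|]; rewrite GE ?FC // Fmod.
Qed.

End Qpoly.

(** * Absence of torsion *)

Section TorsionFree.
Variable n : nat.

Definition torsion_free (A : zmodType) := forall x : A, x *+ n = 0 -> x = 0.

Lemma torsion_free_int : (0 < n)%N -> torsion_free int.
Proof. by move=> n0 x /eqP; rewrite -mulr_natr mulf_eq0 orbC natz eqz_nat (gtn_eqF n0) => /eqP. Qed.

Lemma torsion_free_qpoly (R : comNzRingType) (h : {poly R}) :
  torsion_free R -> torsion_free {poly %/ h}.
Proof.
move=> tfR x xn; apply/val_inj/polyP => i; rewrite coef0; apply: tfR.
have /= := congr1 (fun q : {poly %/ h} => (q : {poly R})`_i) xn.
by rewrite raddfMn coefMn coef0.
Qed.

Lemma torsion_free_mpoly (R : comNzRingType) k :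
  torsion_free R -> torsion_free {mpoly R[k]}.
Proof.
move=> tfR x xn; apply/mpolyP => m; rewrite mcoeff0; apply: tfR.
by rewrite -mcoeffMn xn mcoeff0.
Qed.

(** A divisor [c] of [n] is not a zero divisor: multiplying by [d] yields [n (x - y) = 0]. *)
Lemma torsion_free_mulI (A : comPzRingType) (c d x y : A) :
  torsion_free A -> c * d = n%:R -> c * x = c * y -> x = y.
Proof.
move=> tfA cd cxy; apply/eqP; rewrite -subr_eq0; apply/eqP/tfA.
by rewrite -mulr_natl -cd mulrAC mulrBr cxy subrr mul0r.
Qed.

End TorsionFree.

(** * Localization at one element *)

Section Localization.
Variables (A R : comPzRingType) (c : A) (l : {rmorphism A -> R}).
Hypothesis locl : is_localization_at c l.

Lemma localization_ext (B : comPzRingType) (F G : {rmorphism R -> B}) :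
  (forall x, F (l x) = G (l x)) -> F =1 G.
Proof.
move=> FG y; have [uc /(_ y)[x [k yx]] _] := locl.
apply: (is_unit_mulIr (rmorph_is_unit F (is_unitX k uc))).
by rewrite -rmorphM yx FG -yx rmorphM rmorphXn -FG -rmorphXn.
Qed.

Lemma localization_lift (B : comPzRingType) (f : {rmorphism A -> B}) :
  is_unit (f c) -> exists F : {rmorphism R -> B}, forall x, F (l x) = f x.
Proof.
move=> ufc; have [uc surjl kerl] := locl; have ufcX k := is_unitX k ufc.
(* [P y z] asks that [z] be the right value for every way of writing [y] as a fraction, so that any
   such fraction may be used below. *)
pose P y z := forall x k, y * l c ^+ k = l x -> z * f c ^+ k = f x.
(* Elements with equal images differ by one killed by a power of [c], which [f] maps to a unit. *)
have eqf x x' : l x = l x' -> f x = f x'.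
  move=> lx; have [|k] := kerl (x - x'); first by rewrite rmorphB lx subrr.
  move=> /(congr1 f); rewrite rmorph0 rmorphM rmorphXn rmorphB mulrC mulrBl.
  by move/eqP; rewrite subr_eq0 => /eqP/(is_unit_mulIr (ufcX k)).
have exP y : exists z, P y z.
  have [x [k yx]] := surjl y; have [u fu] := ufcX k.
  exists (f x * u) => x' k' yx'; apply: (is_unit_mulIr (ufcX k)).
  have <- : f x * f c ^+ k' = f x' * f c ^+ k.
    rewrite -!rmorphXn -!rmorphM; apply: eqf.
    by rewrite !rmorphM !rmorphXn -yx -yx' mulrAC.
  by rewrite mulrAC -[f x * u * _]mulrA [u * _]mulrC fu mulr1.
have [F FP] := choice exP.
have FE y x k : y * l c ^+ k = l x -> F y * f c ^+ k = f x by apply: FP.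
have Fl x : F (l x) = f x by have := FE (l x) x 0%N; rewrite !mulr1; apply.
have [|||G GE] := @rmorphism_of R B F; last by exists G => x; rewrite GE.
- by rewrite -(rmorph1 l) Fl rmorph1.
- move=> y y'; have [[x [k yx]] [x' [k' yx']]] := (surjl y, surjl y').
  apply: (is_unit_mulIr (ufcX (k + k')%N)).
  rewrite (FE _ (x * c ^+ k' + x' * c ^+ k)); last first.
    rewrite rmorphD !rmorphM !rmorphXn -yx -yx' exprD; ring.
  rewrite rmorphD !rmorphM !rmorphXn -(FE _ _ _ yx) -(FE _ _ _ yx') exprD; ring.
- move=> y y'; have [[x [k yx]] [x' [k' yx']]] := (surjl y, surjl y').
  apply: (is_unit_mulIr (ufcX (k + k')%N)).
  rewrite (FE _ (x * x')); last by rewrite rmorphM -yx -yx' exprD; ring.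
  rewrite rmorphM -(FE _ _ _ yx) -(FE _ _ _ yx') exprD; ring.
Qed.

Lemma torsion_free_localization n : torsion_free n A -> torsion_free n R.
Proof.
move=> tfA y yn; have [uc surjl kerl] := locl; have [x [k yx]] := surjl y.
have [|m cx] := kerl (x *+ n).
  by rewrite rmorphMn -yx -mulrnAl yn mul0r.
have lcx : l (c ^+ m * x) = 0.
  by rewrite (tfA (c ^+ m * x)) ?rmorph0 // -mulrnAr.
apply: (is_unit_mulIr (is_unitX k uc)); rewrite mul0r yx.
by apply: (is_unit_mulIr (is_unitX m uc)); rewrite mul0r mulrC -rmorphXn -rmorphM.
Qed.

End Localization.

(** * The ring Z[rho] and the twisted norm *)

Lemma leq_sub2_pred p i : (i < p.-1 -> i <= p - 2)%N.
Proof. by case: p => [|[|n]] //; rewrite subSS subSS subn0 ltnS. Qed.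

Lemma subS_pred p i : (i < p.-1 -> (p - 2 - i).+1 = p.-1 - i)%N.
Proof. by case: p => [|[|n]] //; rewrite !subSS subn0 ltnS => /subSn ->. Qed.

Section Zrho.
Variables (p : nat) (p_prime : prime p).
Local Notation rho := (Defs.rho p).
Local Notation eta := (Defs.eta p).
Let p_gt0 := prime_gt0 p_prime.
Let p_gt1 := prime_gt1 p_prime.
Let hm := mk_monic_cyclo_poly p_prime.

Lemma sum_rho : \sum_(i < p) rho ^+ i = 0.
Proof.
rewrite -[RHS](in_qpoly_mod hm) [X in in_qpoly _ X]/cyclo_poly rmorph_sum.
by apply: eq_bigr => i _; rewrite rmorphXn.
Qed.

Lemma rho_expp : rho ^+ p = 1.
Proof. by apply/eqP; rewrite -subr_eq0 subrX1 sum_rho mulr0. Qed.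

Lemma rho_modp k : rho ^+ (k %% p) = rho ^+ k.
Proof. by rewrite [in RHS](divn_eq k p) exprD mulnC exprM rho_expp expr1n mul1r. Qed.

Lemma torsion_free_Zrho : torsion_free p (Zrho p).
Proof. exact/torsion_free_qpoly/torsion_free_int. Qed.

Lemma qpolyC_int (z : int) : qpolyC (cyclo_poly p) z = z%:~R.
Proof. by rewrite -(rmorph_int (qpolyC (cyclo_poly p))) intz. Qed.

Lemma Zrho_expand (x : Zrho p) :
  x = \sum_(i < size (x : {poly int})) ((x : {poly int})`_i)%:~R * rho ^+ i.
Proof.
by rewrite [LHS]qpoly_expand; apply: eq_bigr => i _; rewrite qpolyC_int.
Qed.

Lemma Zrho_ext (B : comPzRingType) (F G : {rmorphism Zrho p -> B}) :
  F rho = G rho -> F =1 G.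
Proof. by apply: qpoly_ext => z; rewrite qpolyC_int !rmorph_int. Qed.

Lemma Zrho_lift (B : comPzRingType) (b : B) : \sum_(i < p) b ^+ i = 0 ->
  exists F : {rmorphism Zrho p -> B}, F rho = b.
Proof.
move=> sb; have [|F [_ FX]] := @qpoly_lift int _ hm B intr b; last by exists F.
move=> F FC FX; rewrite /cyclo_poly rmorph_sum -[RHS]sb.
by apply: eq_bigr => i _; rewrite rmorphXn FX.
Qed.

(** Multiplication by [a] permutes the residues modulo [p], so the sum is only reordered. *)
Lemma sum_expr_coprime (B : comPzRingType) (b : B) a : \sum_(i < p) b ^+ i = 0 ->
  ~~ (p %| a)%N -> \sum_(i < p) (b ^+ a) ^+ i = 0.
Proof.
move=> sb pa; have bp : b ^+ p = 1 by apply/eqP; rewrite -subr_eq0 subrX1 sb mulr0.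
have bm k : b ^+ (k %% p) = b ^+ k.
  by rewrite [in RHS](divn_eq k p) exprD mulnC exprM bp expr1n mul1r.
pose h (i : 'I_p) : 'I_p := Ordinal (ltn_pmod (a * i) p_gt0).
have injh : injective h.
  move=> i j /(congr1 val) /= /eqP e; apply/val_inj => /=.
  wlog ij : i j e / (i <= j)%N => [H|].
    by have [/H->//|/ltnW/H->//] := leqP i j; rewrite eq_sym.
  move: e; rewrite eq_sym eqn_mod_dvd ?leq_mul2l ?ij ?orbT // -mulnBr.
  rewrite Euclid_dvdM // (negPf pa) /= => pij; apply/eqP; rewrite eqn_leq ij /=.
  rewrite -subn_eq0; apply: contraLR pij; rewrite -lt0n => ji0.
  by rewrite gtnNdvd // (leq_ltn_trans (leq_subr _ _)).
rewrite -[RHS]sb [RHS](reindex_inj injh); apply: eq_bigr => i _ /=.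
by rewrite bm exprM.
Qed.

End Zrho.

Section CycloData.
Variables (p : nat) (p_prime : prime p) (D : cyclo_data p).
Local Notation rho := (Defs.rho p).
Local Notation eta := (Defs.eta p).
Local Notation s := (ns D).
Local Notation r := (nr D).
Local Notation tau := (tau0 D).
Local Notation dlt := (delta D).
Let p_gt0 := prime_gt0 p_prime.
Let p_gt1 := prime_gt1 p_prime.

Lemma eta_dvdp : eta * (xi D * eta ^+ p.-2) = p%:R.
Proof. by rewrite (xiE D) mulrCA -exprS prednK // ltn_predRL. Qed.

(** Otherwise [eta = 0], and [p = xi eta^(p-1)] would vanish, whereas [Z[rho]] is nonzero without
    [p]-torsion. *)
Lemma rho_neq1 : rho != 1.
Proof.
apply/eqP => r1; have := oner_neq0 (Zrho p); case/eqP.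
apply: (torsion_free_Zrho p_prime); rewrite (xiE D) /Defs.eta r1 subrr expr0n.
by rewrite -subn1 subn_eq0 leqNgt p_gt1 mulr0.
Qed.

(** For [c] prime to [p], a Bezout relation would give [rho = 1]. *)
Lemma rho_exp1 c : rho ^+ c = 1 -> (p %| c)%N.
Proof.
move=> rc; apply: contraT => pc; have := rho_neq1; case/eqP.
have c0 : (0 < c)%N by case: (c) pc => //; rewrite dvdn0.
have := egcdnP p c0; case=> u v e _.
have : rho ^+ (u * c) = rho.
  rewrite e (eqP (_ : coprime c p)) ?exprD ?[(v * p)%N]mulnC ?exprM ?rho_expp // ?expr1n ?mul1r //.
  by rewrite coprime_sym prime_coprime.
by rewrite mulnC exprM rc expr1n.
Qed.

Lemma rho_expI a b : rho ^+ a = rho ^+ b -> a = b %[mod p].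
Proof.
wlog ab : a b / (a <= b)%N => [H|].
  by have [/H//|/ltnW/H ba /esym/ba] := leqP a b.
rewrite -{1}(subnK ab) exprD => /esym e; apply/eqP; rewrite eq_sym eqn_mod_dvd //.
apply: rho_exp1; have ra : rho ^+ a * rho ^+ (p * a - a) = 1.
  by rewrite -exprD subnKC ?leq_pmull // exprM rho_expp // expr1n.
by rewrite -[LHS]mulr1 -ra mulrA e ra.
Qed.

Lemma tau_iter_rho k : iter k tau rho = rho ^+ (s ^ k).
Proof.
by elim: k => //= k ->; rewrite rmorphXn tau0_rho -exprM -expnS.
Qed.

Lemma expns_modp : (s ^ p.-1 = 1 %[mod p])%N.
Proof. by rewrite (nsE D) -addn1 mulnC modnMDl. Qed.

Lemma tau_order (x : Zrho p) : iter p.-1 tau x = x.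
Proof.
have := @Zrho_ext p _ (GRing.RMorphism.clone _ _ (iter p.-1 tau) _) idfun.
by apply; rewrite /= tau_iter_rho -rho_modp // expns_modp rho_modp.
Qed.

Lemma rho_power_sum a : ~~ (p %| a)%N -> \sum_(i < p) (rho ^+ a) ^+ i = 0.
Proof. exact/sum_expr_coprime/sum_rho. Qed.

(* Every automorphism [rho |-> rho ^ a] is a power of [tau]. *)
Lemma ns_generates a : ~~ (p %| a)%N -> exists k, a = s ^ k %[mod p].
Proof.
move=> pa; have a0 : (0 < a)%N by case: (a) pa => //; rewrite dvdn0.
have [F Frho] := Zrho_lift p_prime (rho_power_sum pa).
have [u v e _] := egcdnP p a0.
have ua : u * a = 1 %[mod p].
  by rewrite e (eqP (_ : coprime a p)) ?modnMDl // coprime_sym prime_coprime.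
have pu : ~~ (p %| u)%N.
  apply/negP => /dvdnP[q qE]; move: ua; rewrite qE mulnAC modnMl modn_small //.
have [G Grho] := Zrho_lift p_prime (rho_power_sum pu).
have bijF : bijective F.
  exists G.
    apply: (@Zrho_ext p _ (GRing.RMorphism.clone _ _ (G \o F) _) idfun).
    by rewrite /= Frho rmorphXn Grho -exprM -rho_modp // ua rho_modp.
  apply: (@Zrho_ext p _ (GRing.RMorphism.clone _ _ (F \o G) _) idfun).
  by rewrite /= Grho rmorphXn Frho -exprM mulnC -rho_modp // ua rho_modp.
have [k Fk] := tau0_gen D bijF; exists k.
by apply: rho_expI; rewrite -Frho Fk tau_iter_rho.
Qed.

Lemma expns_mod_pred k : s ^ k = s ^ (k %% p.-1) %[mod p].
Proof.
rewrite [in LHS](divn_eq k p.-1) expnD mulnC [(_ %/ _ * _)%N]mulnC expnM.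
by rewrite -modnMmr -modnXm expns_modp modnXm exp1n modnMmr muln1.
Qed.

Lemma ndvdn_expns k : ~~ (p %| s ^ k)%N.
Proof.
apply/negP => ps; have : (p %| s ^ (k + p.-1))%N by rewrite expnD dvdn_mulr.
have : (p %| s)%N.
  by case: k ps => [|k]; [rewrite dvdn1 gtn_eqF | rewrite Euclid_dvdX // => /andP[]].
move=> ps' _; have : (p %| s ^ p.-1)%N.
  by rewrite Euclid_dvdX // ps' -subn1 subn_gt0.
by rewrite /dvdn expns_modp modn_small.
Qed.

(** The powers of [s] exhaust the nonzero residues by [ns_generates]; as there are [p - 1] indices
    on each side, the reindexing [h] is a bijection. *)
Lemma sum_expns (V : nmodType) (F : nat -> V) :
  \sum_(i < p.-1) F (s ^ i %% p)%N = \sum_(i < p.-1) F i.+1.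
Proof.
pose h0 (i : 'I_p.-1) : nat := (s ^ i %% p).-1.
have h0S (i : 'I_p.-1) : (h0 i).+1 = (s ^ i %% p)%N.
  by rewrite prednK // lt0n; apply: ndvdn_expns.
have hp (i : 'I_p.-1) : (h0 i < p.-1)%N.
  by rewrite -ltnS h0S prednK // ltn_pmod.
pose h i : 'I_p.-1 := Ordinal (hp i).
have injh : injective h.
  apply/injectiveP; apply/card_uniqP; rewrite size_map -cardE.
  apply: eq_card => j; rewrite [RHS]inE; apply/codomP.
  have [|k jk] := @ns_generates j.+1.
    by rewrite gtnNdvd // -ltn_predRL.
  have p10 : (0 < p.-1)%N by rewrite -subn1 subn_gt0.
  exists (Ordinal (ltn_pmod k p10)); apply/val_inj/eqP; rewrite -eqSS h0S /=.
  by rewrite -expns_mod_pred -jk modn_small // -ltn_predRL.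
rewrite [RHS](reindex_inj injh); apply: eq_bigr => i _.
by rewrite -h0S.
Qed.

(** By [sum_expns], the indicator of the residue 1 sums to 1 over the powers [s^i], and [i = 0]
    already contributes. *)
Lemma expns_eq1 i : (i < p.-1)%N -> s ^ i = 1 %[mod p] -> i = 0%N.
Proof.
move=> ip si; have p10 : (0 < p.-1)%N by apply: leq_ltn_trans ip.
have := @sum_expns nat (fun a => (a == 1)%N : nat).
rewrite [RHS](bigD1 (Ordinal p10)) //= [X in _ = (_ + X)%R]big1 => [|j]; last first.
  by rewrite -val_eqE /= eqSS => /negPf ->.
have [[//]|i0] := eqVneq (Ordinal ip) (Ordinal p10).
by rewrite (bigD1 (Ordinal p10)) // (bigD1 (Ordinal ip)) //= si expn0 modn_small.
Qed.

(** By [sum_expns] the exponents run over the nonzero residues; only the term 1 is missing from the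
    vanishing sum of all powers of [rho^a]. *)
Lemma sum_rho_conj a : ~~ (p %| a)%N -> \sum_(i < p.-1) rho ^+ (a * s ^ i) = -1.
Proof.
move=> pa; apply/eqP; rewrite -addr_eq0; apply/eqP.
rewrite -[RHS](rho_power_sum pa) -(big_mkord xpredT (fun i => (rho ^+ a) ^+ i)).
rewrite [RHS]big_ltn // big_add1 big_mkord expr0 addrC; congr (_ + _).
transitivity (\sum_(i < p.-1) (rho ^+ a) ^+ (s ^ i %% p)).
  by apply: eq_bigr => i _; rewrite -exprM -rho_modp // -[RHS]rho_modp // modnMmr.
exact: (sum_expns (fun b => (rho ^+ a) ^+ b)).
Qed.

(** For [u] inverse to [k] modulo [p], [eta = rho^(u k) - 1] is a geometric sum times
    [rho^k - 1]. *)
Lemma dvd_rho_sub1_eta k : ~~ (p %| k)%N -> exists q, (rho ^+ k - 1) * q = eta.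
Proof.
move=> pk; have k0 : (0 < k)%N by case: (k) pk => //; rewrite dvdn0.
have [u v e _] := egcdnP p k0; exists (\sum_(i < u) (rho ^+ k) ^+ i).
rewrite -subrX1 -exprM mulnC e (eqP (_ : coprime k p)).
  by rewrite exprD mulnC exprM rho_expp // expr1n mul1r.
by rewrite coprime_sym prime_coprime.
Qed.

Lemma tau_eta : tau eta = dlt * eta.
Proof. by rewrite rmorphB rmorph1 tau0_rho subrX1 mulrC. Qed.

Section TorsionFreeAlgebra.
Variables (A : comPzRingType) (j : {rmorphism Zrho p -> A}).
Hypothesis tfA : torsion_free p A.

Lemma etaX_inj k x y : j eta ^+ k * x = j eta ^+ k * y -> x = y.
Proof.
elim: k => [|k IH]; first by rewrite !mul1r.
rewrite exprS -!mulrA => /(torsion_free_mulI (d := j (xi D * eta ^+ p.-2)) tfA) xy.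
by apply/IH/xy; rewrite -rmorphM eta_dvdp rmorph_nat.
Qed.

Lemma eta_inj x y : j eta * x = j eta * y -> x = y.
Proof. exact: (@etaX_inj 1). Qed.

End TorsionFreeAlgebra.

Let etaZ_inj := @etaX_inj (Zrho p) idfun (torsion_free_Zrho p_prime).

Lemma iter_tau_eta k : iter k tau eta = (\prod_(i < k) iter i tau dlt) * eta.
Proof.
elim: k => [|k IH]; first by rewrite big_ord0 mul1r.
rewrite iterSr tau_eta rmorphM /= IH mulrA big_ord_recr /=; congr (_ * _).
exact: mulrC.
Qed.

(** Multiplied by [eta], the product becomes [tau^(p-1) eta = eta]. So [delta] has norm 1, and in
    particular is a unit. *)
Lemma prod_tau_delta : \prod_(i < p.-1) iter i tau dlt = 1.
Proof.
by apply: (@etaZ_inj 1%N); rewrite /= expr1 mulr1 mulrC -iter_tau_eta tau_order.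
Qed.

Lemma is_unit_delta : is_unit dlt.
Proof.
have p10 : (0 < p.-1)%N by rewrite -subn1 subn_gt0.
have := is_unit1 (Zrho p); rewrite -prod_tau_delta (bigD1 (Ordinal p10)) //=.
exact: is_unitMl.
Qed.

(** Compare [p = xi eta^(p-1)] with its image under [tau]. *)
Lemma delta_xi : dlt ^+ p.-1 * tau (xi D) = xi D.
Proof.
apply: (@etaZ_inj p.-1); rewrite /= [RHS]mulrC -(xiE D).
rewrite -[RHS](rmorph_nat tau) (xiE D) rmorphM rmorphXn tau_eta exprMn; ring.
Qed.

(* [x |-> x ^ p + g x], an isogeny from the law with parameter [eta] to the one
   with parameter [eta ^ p]. *)
Section Isogeny.
Variables (A : comPzRingType) (j : {rmorphism Zrho p -> A}).

Definition isog (x : A) : A :=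
  x ^+ p + j (xi D) * \sum_(1 <= i < p) (binom_div p i)%:R * j eta ^+ i.-1 * x ^+ i.

(** Binomial theorem: as [p = xi eta^(p-1)], the middle term [C(p,i) (x eta)^i] is [eta^p] times the
    term [xi b_i eta^(i-1) x^i] of [g]. *)
Lemma one_isog x : 1 + isog x * j eta ^+ p = (1 + x * j eta) ^+ p.
Proof.
rewrite exprDn big_ord_recr -(big_mkord xpredT (fun i =>
  (1 ^+ (p - i) * (x * j eta) ^+ i *+ 'C(p, i)))) big_ltn //=.
rewrite binn bin0 expr0 !expr1n !mul1r !mulr1n exprMn -addrA; congr (_ + _).
rewrite /isog mulrDl addrC; congr (_ + _).
rewrite mulr_sumr mulr_suml; apply: eq_big_nat => i /andP[i0 ip].
have -> : 'C(p, i) = (binom_div p i * p)%N.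
  by rewrite divnK // prime_dvd_bin // i0 ip.
rewrite expr1n mul1r -[in RHS]mulr_natr natrM -[X in _ = _ * (_ * X)](rmorph_nat j) (xiE D).
have -> : j eta ^+ p = j eta * j eta ^+ p.-1 by rewrite -exprS prednK.
have ei : j eta ^+ i = j eta * j eta ^+ i.-1 by rewrite -exprS prednK.
rewrite rmorphM rmorphXn exprMn ei; ring.
Qed.

End Isogeny.

Lemma rmorph_isog (A B : comPzRingType) (j : {rmorphism Zrho p -> A})
    (f : {rmorphism A -> B}) (j' : {rmorphism Zrho p -> B}) x :
  (forall z, f (j z) = j' z) -> f (isog j x) = isog j' (f x).
Proof.
move=> fj; rewrite /isog rmorphD rmorphXn rmorphM fj rmorph_sum; congr (_ + _ * _).
by apply: eq_bigr => i _; rewrite !rmorphM !rmorphXn rmorph_nat fj.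
Qed.

(* Any two elements of a Z[rho]-algebra are images of the variables of a
   torsion free one, where identities can be checked after multiplying by a power
   of eta. *)
Lemma torsion_free_cover (A : comPzRingType) (j : {rmorphism Zrho p -> A}) x y :
  exists (U : comPzRingType) (i : {rmorphism Zrho p -> U}) (f : {rmorphism U -> A}) u v,
    [/\ torsion_free p U, forall z, f (i z) = j z, f u = x & f v = y].
Proof.
have [f [fC fX]] := @mpoly_lift 2 (Zrho p) A j (fun k => if k == 0 then x else y).
exists {mpoly (Zrho p)[2]}, (GRing.RMorphism.clone _ _ (@mpolyC 2 (Zrho p)) _), f.
exists 'X_0, 'X_1; split; rewrite ?fX //.
exact/torsion_free_mpoly/torsion_free_Zrho.
Qed.

Section IsogenyLaws.
Variables (A : comPzRingType) (j : {rmorphism Zrho p -> A}).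

(** In the torsion free cover both sides may be multiplied by [eta^p]; there [one_isog] reduces the
    claim to the multiplicativity of [p]-th powers. *)
Lemma isog_add x y :
  isog j (fg_add (j eta) x y) = fg_add (j eta ^+ p) (isog j x) (isog j y).
Proof.
have [U [i [f [u [v [tfU fi <- <-]]]]]] := torsion_free_cover j x y.
rewrite -fi -rmorph_fg_add -!(rmorph_isog _ fi) -rmorphXn -rmorph_fg_add.
congr (f _); apply: (etaX_inj tfU (j := i) (k := p)); apply: (addrI 1).
by rewrite ![i eta ^+ p * _]mulrC one_isog !one_fg_add !one_isog exprMn.
Qed.

Lemma isog_muln n x : isog j (fg_muln (j eta) n x) = fg_muln (j eta ^+ p) n (isog j x).
Proof.
elim: n => [|n IH]; last by rewrite !fg_mulnS isog_add IH.
rewrite /isog expr0n gtn_eqF // add0r big_nat big1 ?mulr0 // => i /andP[i0 _].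
by rewrite expr0n gtn_eqF // mulr0.
Qed.

Lemma isog_sum (I : Type) (r : seq I) (P : pred I) (F : I -> A) :
  isog j (\big[fg_add (j eta)/0]_(i <- r | P i) F i)
  = \big[fg_add (j eta ^+ p)/0]_(i <- r | P i) isog j (F i).
Proof. exact: (big_morph (isog j) isog_add (isog_muln 0 0)). Qed.

(** Multiplication by [p] in the law factors through the isogeny: both sides correspond to
    [(1 + x eta)^p]. *)
Lemma fg_mulp x : fg_muln (j eta) p x = j eta ^+ p.-1 * isog j x.
Proof.
have [U [i [f [u [v [tfU fi <- _]]]]]] := torsion_free_cover j x x.
rewrite -fi -rmorph_fg_muln -!(rmorph_isog _ fi) -rmorphXn -rmorphM.
congr (f _); apply: (eta_inj tfU (j := i)); apply: (addrI 1).
by rewrite mulrC one_fg_muln -one_isog mulrA -exprS prednK // mulrC.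
Qed.

(** The element 1 corresponds to [1 + eta = rho], a [p]-th root of unity. The kernel of the isogeny
    thus contains 1, and [theta |-> rho theta + 1] is the translation by it. *)
Lemma isog1 : isog j 1 = 0.
Proof.
rewrite -(rmorph1 j) -(@rmorph_isog _ _ idfun j j 1) // -[RHS](rmorph0 j).
congr (j _); apply: (@etaZ_inj p) => /=; apply: (addrI 1).
rewrite mulr0 addr0 mulrC (one_isog idfun) /= mul1r /Defs.eta addrC subrK.
exact: rho_expp.
Qed.

End IsogenyLaws.

(** * The twisted norm and its compatibility with the isogeny *)

Section TwistedNorm.
Variables (A : comPzRingType) (j : {rmorphism Zrho p -> A}) (t : {rmorphism A -> A}).
Hypothesis tj : forall z, t (j z) = j (tau z).

Definition twist (d x : A) := d * t x.

(** [normP] is the case [e = eta^p], [d = delta^p]. The case [e = eta], [d = delta] produces the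
    generator, and the isogeny carries it to the former. *)
Definition tnorm (e d x : A) : A :=
  \big[fg_add e/0]_(i < p.-1) fg_muln e (s ^ (p - 2 - i)) (iter i (twist d) x).

(** [t] maps the law of parameter [e] to that of parameter [d e], and multiplication by [d] brings
    it back. *)
Lemma twist_add e d x y : t e = d * e ->
  twist d (fg_add e x y) = fg_add e (twist d x) (twist d y).
Proof. by move=> te; rewrite /twist rmorph_fg_add te fg_scale_add. Qed.

Lemma twist_muln e d n x : t e = d * e ->
  twist d (fg_muln e n x) = fg_muln e n (twist d x).
Proof. by move=> te; rewrite /twist rmorph_fg_muln te fg_scale_muln. Qed.

Lemma twist_sum e d (I : Type) (r : seq I) (P : pred I) (F : I -> A) : t e = d * e ->
  twist d (\big[fg_add e/0]_(i <- r | P i) F i)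
  = \big[fg_add e/0]_(i <- r | P i) twist d (F i).
Proof. by move=> te; rewrite /twist rmorph_fg_sum te fg_scale_sum. Qed.

Lemma one_iter_twist e d i x : t e = d * e ->
  1 + iter i (twist d) x * e = iter i t (1 + x * e).
Proof.
move=> te; elim: i => //= i <-; rewrite rmorphD rmorph1 rmorphM te /twist; ring.
Qed.

Lemma one_tnorm e d x : t e = d * e ->
  1 + tnorm e d x * e = \prod_(i < p.-1) iter i t (1 + x * e) ^+ (s ^ (p - 2 - i)).
Proof.
move=> te; rewrite one_fg_sum; apply: eq_bigr => i _.
by rewrite one_fg_muln one_iter_twist.
Qed.

Lemma iter_twist d i x : iter i (twist d) x = (\prod_(k < i) iter k t d) * iter i t x.
Proof.
elim: i x => [|i IH] x; first by rewrite big_ord0 mul1r.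
rewrite iterSr IH /twist rmorphM /= -iterSr mulrA big_ord_recr /=; congr (_ * _).
Qed.

Let t_eta : t (j eta) = j dlt * j eta.
Proof. by rewrite tj tau_eta rmorphM. Qed.

(** The coefficients of [g] match by [delta_xi], since
    [delta^p tau(xi) delta^(i-1) = xi delta^i]. *)
Lemma isog_twist x : isog j (twist (j dlt) x) = twist (j dlt ^+ p) (isog j x).
Proof.
rewrite /twist /isog exprMn (rmorphD t) mulrDr (rmorphXn t); congr (_ + _).
rewrite (rmorphM t) (rmorph_sum t) !mulr_sumr; apply: eq_big_nat => i /andP[i0 ip].
rewrite !(rmorphM t) !(rmorphXn t) (rmorph_nat t) t_eta tj !exprMn.
rewrite -{1}delta_xi (rmorphM j) (rmorphXn j).
have -> : j dlt ^+ p = j dlt * j dlt ^+ p.-1 by rewrite -exprS prednK.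
have -> : j dlt ^+ i = j dlt * j dlt ^+ i.-1 by rewrite -exprS prednK.
ring.
Qed.

Lemma tnorm_add e d x y : t e = d * e ->
  tnorm e d (fg_add e x y) = fg_add e (tnorm e d x) (tnorm e d y).
Proof.
move=> te; rewrite -big_split; apply: eq_bigr => i _ /=; rewrite -fg_muln_add.
by congr fg_muln; elim: (i : nat) => //= k ->; rewrite twist_add.
Qed.

Lemma isog_tnorm x :
  isog j (tnorm (j eta) (j dlt) x) = tnorm (j eta ^+ p) (j dlt ^+ p) (isog j x).
Proof.
rewrite isog_sum; apply: eq_bigr => i _; rewrite isog_muln; congr fg_muln.
by elim: (i : nat) => //= k IH; rewrite isog_twist IH.
Qed.

(* Both sides are [fg_sum] of [s ^ (p - 1 - i) * (d t)^i x] over [0 <= i < p]. *)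
Lemma twist_tnorm e d x : t e = d * e ->
  fg_add e (fg_muln e s (tnorm e d x)) (iter p.-1 (twist d) x)
  = fg_add e (fg_muln e (s ^ p.-1) x) (twist d (tnorm e d x)).
Proof.
move=> te; pose G i := fg_muln e (s ^ (p.-1 - i)) (iter i (twist d) x).
transitivity (\big[fg_add e/0]_(i < p.-1.+1) G i).
  rewrite big_ord_recr /= {2}/G subnn expn0 fg_muln1 fg_muln_sum; congr fg_add.
  apply: eq_bigr => i _; rewrite -fg_mulnA -expnS /G; congr (fg_muln _ (_ ^ _) _).
  exact: subS_pred.
rewrite big_ord_recl twist_sum // {1}/G subn0; congr fg_add.
apply: eq_bigr => i _; rewrite twist_muln // /G; congr (fg_muln _ (_ ^ _) _).
by rewrite /= /bump add1n subnS -subS_pred.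
Qed.

(** As [delta] has norm 1, [(delta t)^(p-1) x = x]. In [twist_tnorm] write [s^(p-1) = p r + 1] and
    use that multiplication by [p] is [eta^(p-1)] times the isogeny; then [x] cancels. *)
Lemma tnorm_relation x : is_unit (1 + x * j eta) -> iter p.-1 t x = x ->
  fg_muln (j eta) s (tnorm (j eta) (j dlt) x)
  = fg_add (j eta) (fg_muln (j eta ^+ p) r (isog j x) * j eta ^+ p.-1)
      (twist (j dlt) (tnorm (j eta) (j dlt) x)).
Proof.
move=> ux tx; apply: (fg_addIr ux).
have ix : iter p.-1 (twist (j dlt)) x = x.
  rewrite iter_twist tx (_ : \prod_(_ < _) _ = 1) ?mul1r //.
  rewrite -[RHS](rmorph1 j) -prod_tau_delta rmorph_prod.
  by apply: eq_bigr => i _; rewrite (iter_commute i tj).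
have := twist_tnorm x t_eta; rewrite ix => ->.
rewrite (nsE D) -addn1 fg_mulnD fg_muln1 mulnC fg_mulnA fg_mulp.
have -> : j eta ^+ p = j eta ^+ p.-1 * j eta by rewrite -exprSr prednK.
rewrite -fg_scale_muln [_ ^+ _ * fg_muln _ _ _]mulrC.
by rewrite -!fg_addA; congr fg_add; apply: fg_addC.
Qed.

End TwistedNorm.

Lemma rmorph_tnorm (A B : comPzRingType) (f : {rmorphism A -> B})
    (t : {rmorphism A -> A}) (t' : {rmorphism B -> B}) e d x :
  (forall z, t' (f z) = f (t z)) ->
  f (tnorm t e d x) = tnorm t' (f e) (f d) (f x).
Proof.
move=> ft; rewrite rmorph_fg_sum; apply: eq_bigr => i _; rewrite rmorph_fg_muln.
by congr fg_muln; elim: (i : nat) => //= k IH; rewrite rmorphM -ft IH.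
Qed.

(** Since [1 + eta = rho], each of the [p - 1] factors contributes [k s^i s^(p-2-i) = k s^(p-2)] to
    the exponent of [rho], and [k] is chosen to make the total 1 modulo [p]. *)
Lemma tnorm_one k : (k * (p.-1 * s ^ (p - 2)) = 1 %[mod p])%N ->
  tnorm tau eta dlt (fg_muln eta k 1) = 1.
Proof.
move=> km; apply: (@etaZ_inj 1%N); rewrite /= expr1; apply: (addrI 1).
rewrite mulrC one_tnorm ?tau_eta // one_fg_muln mul1r mulr1.
have -> : 1 + eta = rho by rewrite addrC subrK.
rewrite (eq_bigr (fun=> rho ^+ (k * s ^ (p - 2)))) => [|i _]; last first.
  rewrite rmorphXn /= tau_iter_rho -!exprM mulnCA -expnD subnKC //.
  exact: leq_sub2_pred.
rewrite prodr_const card_ord -exprM -rho_modp //.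
by rewrite -mulnA [(s ^ _ * _)%N]mulnC km rho_modp.
Qed.

(* Passing from [x] to its twisted norm multiplies the [sigma]-weight by
   [(p - 1) s ^ (p - 2)]; replacing [x] by [k * x] first compensates for it. *)
Lemma twisted_kummer_generator (A : comPzRingType) (j : {rmorphism Zrho p -> A})
    (t sg : {rmorphism A -> A}) x0 :
  (forall z, t (j z) = j (tau z)) -> (forall z, sg (j z) = j z) ->
  (forall x, sg (t x) = t (sg x)) -> (forall x, iter p.-1 t x = x) ->
  is_unit (1 + x0 * j eta) -> sg x0 = j rho * x0 + 1 ->
  exists u th,
    [/\ is_unit (1 + u * j eta ^+ p), sg u = u, sg th = j rho * th + 1,
        isog j th = tnorm t (j eta ^+ p) (j dlt ^+ p) u &
        fg_muln (j eta) s th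
        = fg_add (j eta) (fg_muln (j eta ^+ p) r u * j eta ^+ p.-1) (j dlt * t th)].
Proof.
move=> tj sj st tp ux0 sx0.
have sadd x : fg_add (j eta) x 1 = j rho * x + 1.
  by rewrite /fg_add /Defs.eta rmorphB rmorph1; ring.
have [k km] : exists k, (k * (p.-1 * s ^ (p - 2)) = 1 %[mod p])%N.
  have pm : ~~ (p %| p.-1 * s ^ (p - 2))%N.
    rewrite Euclid_dvdM // negb_or ndvdn_expns andbT gtnNdvd ?ltn_predL //.
    by rewrite -subn1 subn_gt0.
  have m0 : (0 < p.-1 * s ^ (p - 2))%N by case: (_ * _)%N pm => //; rewrite dvdn0.
  have [k v e _] := egcdnP p m0; exists k.
  by rewrite e (eqP (_ : coprime _ p)) ?modnMDl // coprime_sym prime_coprime.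
pose x := fg_muln (j eta) k x0; pose u := isog j x.
have sx : sg x = fg_add (j eta) x (fg_muln (j eta) k 1).
  by rewrite rmorph_fg_muln sj sx0 -sadd fg_muln_add.
have ux : is_unit (1 + x * j eta) by rewrite one_fg_muln; apply: is_unitX.
have t_eta : t (j eta) = j dlt * j eta by rewrite tj tau_eta rmorphM.
exists u, (tnorm t (j eta) (j dlt) x); split.
- by rewrite one_isog; apply: is_unitX.
(* The isogeny kills 1, so adding a multiple of 1 to [x] leaves [u] unchanged. *)
- rewrite /u (rmorph_isog x sj) sx isog_add isog_muln isog1 fg_mulnx0.
  by rewrite fg_addC fg_add0.
- rewrite (rmorph_tnorm _ _ _ (t' := t)); last by move=> z; rewrite st.
  rewrite !sj sx tnorm_add // -(rmorph1 j) -rmorph_fg_muln.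
  rewrite -(rmorph_tnorm (t := tau)) // tnorm_one // rmorph1; exact: sadd.
- exact: isog_tnorm.
- exact: tnorm_relation.
Qed.

End CycloData.

(** * Generators over semilocal rings *)

Section EigenAvoidance.
Variables (p : nat) (p_gt0 : (0 < p)%N).
Variables (F : comPzRingType) (E : cyclic_alg F) (galE : is_Galois p E).
Local Notation s := (ca_act E).
Local Notation i := (ca_struct E).
Variables (e z : F).
Hypothesis ze : z = 1 + e.
Hypothesis sz : \sum_(k < p) z ^+ k = 0.
Hypothesis e_dvdp : forall N : F -> Prop, is_maximal_ideal N -> N p%:R -> N e.

(** Divisibility descends from [E] to [F]: multiply by an element of trace 1 and take the trace. *)
Lemma Galois_contract (f c : F) (g : E) : i c = i f * g -> exists d, c = f * d.
Proof.
have [_ inji _ _] := galE; have [y y1] := Galois_trace_one p_gt0 galE.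
move=> cfg; have [d dE] := Galois_ctrace p_gt0 galE (g * y); exists d.
apply: inji; rewrite rmorphM -dE -ctraceZ ?ca_act_struct // mulrA -cfg.
by rewrite ctraceZ ?ca_act_struct // y1 mulr1.
Qed.

Let zp : z ^+ p = 1.
Proof. by apply/eqP; rewrite -subr_eq0 subrX1 sz mulr0. Qed.

(* Divided by [e], this is the Lagrange resolvent of [y] minus its trace. *)
Lemma eigen_base : exists th : E, s th = i z * th + 1.
Proof.
have [y y1] := Galois_trace_one p_gt0 galE; have [sp _ _ _] := galE.
(* [q k] stands for [(z^k - 1) / e]. Below, [G 0] and [G p] both equal [y] because [q p = 0], so the
   sum of the [G k] may be shifted by one. *)
pose q k : F := \sum_(m < k) z ^+ m.
have qS k : q k.+1 = 1 + z * q k.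
  rewrite /q big_ord_recl expr0 mulr_sumr; congr (_ + _).
  by apply: eq_bigr => m _; rewrite -exprS.
have q0 : q 0%N = 0 by rewrite /q big_ord0.
exists (\sum_(k < p) i (q (p - k)%N) * iter k s y).
pose G k := i (q (p.+1 - k)%N) * iter k s y.
transitivity (\sum_(k < p) G k.+1).
  rewrite rmorph_sum; apply: eq_bigr => k _.
  by rewrite rmorphM ca_act_struct /G subSS.
transitivity (\sum_(k < p) G k).
  apply: (addrI (G 0%N)).
  transitivity (\sum_(k < p.+1) G k); first by rewrite [RHS]big_ord_recl.
  rewrite big_ord_recr /= addrC; congr (_ + _).
  by rewrite /G subSn // subnn subn0 sp !qS q0 /q sz.
rewrite mulr_sumr -y1 -big_split; apply: eq_bigr => k _.
rewrite /G subSn ?qS 1?ltnW // (rmorphD i) (rmorphM i) (rmorph1 i) /=; ring.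
Qed.

(** The Lagrange resolvent. For [a^p = 1] its values have eigenvalue the inverse of [a], which is
    why the eigenvalue [z] calls for [z^(p-1)] below. *)
Definition resolvent (a : F) (x : E) := \sum_(k < p) i a ^+ k * iter k s x.

Lemma resolvent_eigen a b x : b * a = 1 -> a ^+ p = 1 ->
  s (resolvent a x) = i b * resolvent a x.
Proof.
move=> ba ap; have [sp _ _ _] := galE.
pose G k := i b * i a ^+ k * iter k s x.
have ia k : i b * i a ^+ k.+1 = i a ^+ k.
  by rewrite exprS mulrA -rmorphM ba rmorph1 mul1r.
transitivity (\sum_(k < p) G k.+1).
  rewrite rmorph_sum; apply: eq_bigr => k _.
  by rewrite rmorphM rmorphXn ca_act_struct /G ia.
transitivity (\sum_(k < p) G k).
  apply: (addrI (G 0%N)).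
  transitivity (\sum_(k < p.+1) G k); first by rewrite [RHS]big_ord_recl.
  by rewrite big_ord_recr /= addrC /G sp -rmorphXn ap rmorph1 expr0.
by rewrite mulr_sumr; apply: eq_bigr => k _; rewrite /G mulrA.
Qed.

Lemma eigen_exp_fixed a x : s x = i a * x -> a ^+ p = 1 -> exists c, x ^+ p = i c.
Proof.
have [_ _ fixE _] := galE; move=> sx ap; apply: fixE.
by rewrite rmorphXn sx exprMn -rmorphXn ap rmorph1 mul1r.
Qed.

(* For a dual family [x_j, y_j], the traces of [x_j L y_j], where [L] projects
   onto the eigenspace, are products of opposite eigenvectors with sum [p]. *)
Lemma eigen_outside (N : F -> Prop) : is_maximal_ideal N -> ~ N p%:R ->
  exists (w : E) c, [/\ s w = i z * w, w ^+ p = i c & ~ N c].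
Proof.
move=> maxN Np; have idN := maximal_is_ideal maxN.
have [sp inji fixE [w dw]] := galE.
pose z' := z ^+ p.-1; have zz' : z * z' = 1 by rewrite -exprS prednK.
have z'z : z' * z = 1 by rewrite mulrC.
have z'p : z' ^+ p = 1 by rewrite -exprM mulnC exprM zp expr1n.
have sL x := @resolvent_eigen z' z x zz' z'p.
have sL_iter k x : iter k s (resolvent z' x) = i z ^+ k * resolvent z' x.
  elim: k => [|k IH]; first by rewrite mul1r.
  by rewrite iterS IH rmorphM rmorphXn ca_act_struct sL exprSr mulrA.
have trL (xy : E * E) :
    ctrace p s (xy.1 * resolvent z' xy.2) = resolvent z xy.1 * resolvent z' xy.2.
  rewrite mulr_suml; apply: eq_bigr => k _.
  by rewrite rmorphM /= sL_iter; ring.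
have sum1 : \sum_(xy <- w) xy.1 * resolvent z' xy.2 = 1.
  transitivity (\sum_(k < p) i z' ^+ k * (\sum_(xy <- w) xy.1 * iter k s xy.2)).
    under [RHS]eq_bigr do rewrite mulr_sumr.
    rewrite exchange_big; apply: eq_bigr => xy _; rewrite mulr_sumr.
    by apply: eq_bigr => k _; rewrite mulrCA.
  rewrite (bigD1 (Ordinal p_gt0)) //= (dw 0%N) // mulr1 big1 ?addr0 // => k k0.
  rewrite dw // (_ : (k == 0 :> nat) = false) ?mulr0 //.
  by apply: negbTE; apply: contraNneq k0 => k0; apply/eqP/val_inj.
have [|c cE] := @choice _ _ (fun (xy : E * E) a =>
    ctrace p s (xy.1 * resolvent z' xy.2) = i a).
  by move=> xy; apply: Galois_ctrace.
have pE : p%:R = \sum_(xy <- w) c xy.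
  apply: inji; rewrite rmorph_sum /= rmorph_nat.
  transitivity (ctrace p s (1 : E)).
    rewrite /ctrace (eq_bigr (fun=> 1)) => [|k _]; last exact: rmorph1.
    by rewrite sumr_const card_ord.
  rewrite -sum1 (big_morph (ctrace p s) (ctraceD p s) (_ : _ = 0)).
    by apply: eq_bigr => xy _; rewrite cE.
  by rewrite /ctrace big1 // => k _; rewrite rmorph0.
have [xy Nc] : exists xy, ~ N (c xy).
  apply: contrapT => H; apply: Np; rewrite pE; apply: ideal_sum => // xy _.
  by apply: contrapT => Nc; apply: H; exists xy.
have [d dE] := eigen_exp_fixed (sL xy.2) zp.
have [d' d'E] := eigen_exp_fixed (@resolvent_eigen z z' xy.1 z'z zp) z'p.
(* The [p]-th power of [c xy] is [d' d], so [d] in [N] would put [c xy] there. *)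
exists (resolvent z' xy.2), d; split=> // Nd; apply: Nc.
apply: (maximal_exp maxN (n := p)).
have -> : c xy ^+ p = d' * d.
  by apply: inji; rewrite rmorphXn -cE trL exprMn d'E dE rmorphM.
exact: (ideal_mull idN).
Qed.

Section Avoid.
Variables (T : eqType) (N : T -> F -> Prop).

(* If [c] lies in the next ideal [N t0], adding to [th] a suitable multiple of an
   eigenvector outside [N t0] leaves [c] unchanged modulo the earlier ideals and
   moves it out of [N t0]. *)
Lemma eigen_avoid (l : seq T) : exists (th : E) c,
  [/\ s th = i z * th + 1, (1 + th * i e) ^+ p = i c &
      forall t, t \in l -> is_maximal_ideal (N t) -> ~ N t c].
Proof.
have [sp inji fixE _] := galE.
have pow (th : E) : s th = i z * th + 1 -> exists c, (1 + th * i e) ^+ p = i c.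
  move=> sth; apply: fixE; rewrite rmorphXn rmorphD rmorph1 rmorphM sth ca_act_struct.
  have -> : 1 + (i z * th + 1) * i e = i z * (1 + th * i e).
    by rewrite ze rmorphD rmorph1; ring.
  by rewrite exprMn -rmorphXn zp rmorph1 mul1r.
elim: l => [|t0 l [th [c [sth thc lc]]]].
  by have [th sth] := eigen_base; have [c thc] := pow th sth; exists th, c.
have [[maxN Nc]|ntc] := pselect (is_maximal_ideal (N t0) /\ N t0 c); last first.
  exists th, c; split=> // t; rewrite inE => /predU1P[-> mt|]; last exact: lc.
  by move=> Nc; apply: ntc.
have idN := maximal_is_ideal maxN; have N1 : ~ N t0 1 by case: maxN.
(* [c] is congruent to 1 modulo [e]; as [N t0] contains [c], it does not contain [e], nor therefore
   [p]. *)
have Ne : ~ N t0 e.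
  move=> Ne; apply: N1; have [|d cd] := @Galois_contract e (c - 1)
    (th * \sum_(k < p) (1 + th * i e) ^+ k).
    by rewrite rmorphB rmorph1 -thc subrX1; ring.
  rewrite -(subKr c 1); apply: idealB => //; rewrite cd.
  exact: (ideal_mulr idN).
have [w [d [sw wd Nd]]] : exists (w : E) c, [/\ s w = i z * w, w ^+ p = i c & ~ N t0 c].
  by apply: (eigen_outside maxN) => /(e_dvdp maxN).
(* Each earlier maximal ideal omits [c], hence is not contained in [N t0]; [f] is a product of
   elements witnessing this. *)
have [f Nf lf] : exists2 f, ~ N t0 f & forall t, t \in l -> is_maximal_ideal (N t) -> N t f.
  elim: (l) lc => [|t m IH] mc; first by exists 1.
  have [|f Nf mf] := IH; first by move=> u um; apply: mc; rewrite inE um orbT.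
  have [maxt|nt] := pselect (is_maximal_ideal (N t)); last first.
    by exists f => // u; rewrite inE => /predU1P[->|/mf].
  have [g Ntg N0g] : exists2 g, N t g & ~ N t0 g.
    apply: contrapT => H; apply: (mc t) => //; first by rewrite inE eqxx.
    have tN0 x : N t x -> N t0 x by move=> tx; apply: contrapT => nx; apply: H; exists x.
    by case: maxt => idt t1 /(_ (N t0) idN N1 tN0); apply.
  exists (g * f); first by case/(maximal_mul maxN).
  move=> u; rewrite inE => /predU1P[-> _|um mu].
    exact: (ideal_mulr (maximal_is_ideal maxt)).
  by apply: (ideal_mull (maximal_is_ideal mu)); apply: mf.
pose th' := th + i f * w.
have sth' : s th' = i z * th' + 1.
  by rewrite rmorphD rmorphM sth sw ca_act_struct /th'; ring.
have [c' thc'] := pow th' sth'.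
exists th', c'; split=> // t; rewrite inE => /predU1P[-> _|tl mt]; last first.
  (* [th'] and [th] differ by a multiple of [f], so [f] divides [c' - c], first in [E] and then in
     [F]. *)
  have [|d' cd'] := @Galois_contract f (c' - c)
    (i e * w * \sum_(k < p) (1 + th' * i e) ^+ (p.-1 - k) * (1 + th * i e) ^+ k).
    by rewrite rmorphB -thc -thc' subrXX /th'; ring.
  have idt := maximal_is_ideal mt.
  move=> tc'; apply: (lc t tl mt); rewrite -(subKr c' c); apply: idealB => //.
  by rewrite cd'; apply: (ideal_mulr idt); apply: lf.
(* [1 + th e] and [w] are eigenvectors for the same [z], so their products of degree [p] are fixed.
   They are the terms of the binomial expansion of [c']. *)
have [h hE] : exists h : nat -> F, forall k, (k <= p)%N ->
    i (h k) = (1 + th * i e) ^+ (p - k) * w ^+ k.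
  have [|h hE] := @choice nat F (fun k a => (k <= p)%N ->
      i a = (1 + th * i e) ^+ (p - k) * w ^+ k); last by exists h.
  move=> k; have [kp|kp] := leqP k p; last by exists 0.
  have [|a ->] := fixE ((1 + th * i e) ^+ (p - k) * w ^+ k); last by exists a.
  have sa : s (1 + th * i e) = i z * (1 + th * i e).
    by rewrite rmorphD rmorph1 rmorphM sth ca_act_struct ze rmorphD rmorph1; ring.
  rewrite rmorphM !rmorphXn sa sw !exprMn mulrACA -exprD subnK //.
  by rewrite -rmorphXn zp rmorph1 mul1r.
have c'E : c' = \sum_(k < p.+1) (f * e) ^+ k * h k *+ 'C(p, k).
  apply: inji; rewrite -thc' rmorph_sum.
  have -> : 1 + th' * i e = (1 + th * i e) + i (f * e) * w by rewrite rmorphM /th'; ring.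
  rewrite exprDn; apply: eq_bigr => k _.
  rewrite rmorphMn (rmorphM i (_ ^+ k)) hE; last by rewrite -ltnS.
  rewrite exprMn rmorphXn; congr (_ *+ _); ring.
rewrite c'E big_ord_recr /= binn mulr1n => Nc'.
have hp : h p = d by apply: inji; rewrite hE // subnn expr0 mul1r.
(* For [k < p] the term lies in [N t0], since [h k ^+ p] is a multiple of [c]. What remains is
   [(f e)^p d], a product of elements outside [N t0]. *)
have : N t0 ((f * e) ^+ p * h p).
  rewrite -(addKr (\sum_(k < p) (f * e) ^+ k * h k *+ 'C(p, k)) (_ * _)) addrC.
  apply: idealB => //; apply: ideal_sum => // k _.
  rewrite -mulr_natr; apply: (ideal_mulr idN); apply: (ideal_mull idN).
  apply: (maximal_exp maxN (n := p)).
  have -> : h k ^+ p = c ^+ (p - k) * d ^+ k.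
    apply: inji; rewrite rmorphXn hE; last exact: ltnW.
    by rewrite rmorphM !rmorphXn -thc -wd exprMn -!exprM mulnC [(k * p)%N]mulnC.
  have pk : (0 < p - k)%N by rewrite subn_gt0.
  by rewrite -(prednK pk) exprS -mulrA; apply: (ideal_mulr idN).
rewrite hp => /(maximal_mul maxN)[/(maximal_exp maxN)/(maximal_mul maxN)[]|] //.
Qed.

End Avoid.

End EigenAvoidance.

(* An interface for [E (x) Z[rho]] with [tau = id (x) tau0] and
   [sigma = s (x) id]; [re_coef] is the coefficient of 1 in the basis
   [1, rho, ..., rho ^ (p - 2)]. *)
Record rho_extension (p : nat) (D : cyclo_data p) (E : comPzRingType)
    (s : {rmorphism E -> E}) := RhoExtension {
  re_ring :> comPzRingType;
  re_inl : {rmorphism E -> re_ring};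
  re_inr : {rmorphism Zrho p -> re_ring};
  re_tau : {rmorphism re_ring -> re_ring};
  re_sigma : {rmorphism re_ring -> re_ring};
  re_coef : re_ring -> E;
  re_tau_inl : forall a, re_tau (re_inl a) = re_inl a;
  re_tau_inr : forall z, re_tau (re_inr z) = re_inr (tau0 D z);
  re_sigma_inl : forall a, re_sigma (re_inl a) = re_inl (s a);
  re_sigma_inr : forall z, re_sigma (re_inr z) = re_inr z;
  re_expand : forall x, exists n (c : nat -> E),
    x = \sum_(k < n) re_inl (c k) * re_inr (rho p ^+ k);
  re_coefD : forall x y, re_coef (x + y) = re_coef x + re_coef y;
  re_coefZ : forall a x, re_coef (re_inl a * x) = a * re_coef x;
  re_coef1 : re_coef 1 = 1;
  re_coef_sigma : forall x, re_coef (re_sigma x) = s (re_coef x) }.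

Arguments re_inl {p D E s} r.
Arguments re_inr {p D E s} r.
Arguments re_tau {p D E s} r.
Arguments re_sigma {p D E s} r.
Arguments re_coef {p D E s} r x.
Arguments re_tau_inl {p D E s} r a.
Arguments re_tau_inr {p D E s} r z.
Arguments re_sigma_inl {p D E s} r a.
Arguments re_sigma_inr {p D E s} r z.

(** The tensor product over the integers; the coefficient of 1 sends [b (x) z] to [b] times the
    constant coefficient of the reduced representative of [z]. *)
Lemma rho_extension_exists (p : nat) (p_prime : prime p) (D : cyclo_data p)
    (E : comPzRingType) (s : {rmorphism E -> E}) : inhabited (rho_extension D s).
Proof.
pose iE : {rmorphism int -> E} := GRing.RMorphism.clone _ _ (intr : int -> E) _.
pose iZ : {rmorphism int -> Zrho p} :=
  GRing.RMorphism.clone _ _ (intr : int -> Zrho p) _.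
pose A := tensor iE iZ; pose pu := pure iE iZ.
have tens_0rE b : pu b 0 = 0 by apply/tens_piP; apply: tens_0r.
have [il ilE] := tens_inl_rmorphism iE iZ.
have sE (a : int) : s (iE a) = iE a by rewrite /= rmorph_int.
have [|t tE] := @tens_rlift _ _ _ iE iZ A il
  (GRing.RMorphism.clone _ _ (tens_inr iE iZ \o tau0 D) _).
  by move=> a; rewrite /= !rmorph_int.
have [|||l [lD lE]] := @tens_lift _ _ _ iE iZ E
  (fun b (z : Zrho p) => b *~ (z : {poly int})`_0).
- by move=> b b' z; rewrite mulrzDl.
- by move=> b z z'; rewrite raddfD coefD mulrzDr.
- move=> b a z; rewrite -[b * _]/(b * a%:~R) mulrzr -mulrzA.
  have -> : (iZ a * z : Zrho p) = (z : {poly int}) *~ a :> {poly int}.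
    by rewrite -[iZ a]/(a%:~R) mulrzl raddfMz.
  by rewrite coefMrz mulrzz mulrC.
have l0 : l 0 = 0 by apply: (addrI (l 0)); rewrite -lD !addr0.
apply: (inhabits (@RhoExtension p D E s A il (tens_inr iE iZ) t (tens_mapl iZ sE) l
  _ _ _ _ _ lD _ _ _)).
- by move=> a; rewrite ilE tE rmorph1 mulr1 ilE.
- by move=> z; rewrite tE rmorph1 mul1r.
- by move=> a; rewrite !ilE tens_mapl_pure.
- by move=> z; rewrite tens_mapl_inr.
- elim/tens_ind => [|x y [n [c ->]] [m [d ->]]|b z].
  + by exists 0%N, (fun=> 0); rewrite big_ord0.
  + exists (maxn n m), (fun k => (if (k < n)%N then c k else 0) + (if (k < m)%N then d k else 0)).
    pose h k := tens_inr iE iZ (rho p ^+ k).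
    have W k q (c' : nat -> E) : (k <= q)%N -> \sum_(m < k) il (c' m) * h m
        = \sum_(m < q) il (if (m < k)%N then c' m else 0) * h m.
      move=> kq; rewrite (big_ord_widen q (fun m => il (c' m) * h m) kq) big_mkcond.
      by apply: eq_bigr => i _; case: ifP => // _; rewrite rmorph0 mul0r.
    rewrite (W n (maxn n m)) ?leq_maxl // (W m (maxn n m)) ?leq_maxr // -big_split.
    by apply: eq_bigr => k _; rewrite rmorphD mulrDl.
  + exists (size (z : {poly int})), (fun k => b *~ (z : {poly int})`_k).
    rewrite {1}[z]Zrho_expand (big_morph (pure iE iZ b) (pureDr iE iZ b) (tens_0rE b)).
    apply: eq_bigr => k _; rewrite ilE pureM mulr1 mul1r.
    by rewrite -(mulrzr b) -[X in b * X]/(iE _) pure_bal.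
- move=> a; elim/tens_ind => [|x y IHx IHy|b z].
  + by rewrite mulr0 l0 mulr0.
  + by rewrite mulrDr !lD mulrDr IHx IHy.
  + by rewrite ilE pureM mul1r !lE mulrzAr.
- by rewrite lE coefC.
- elim/tens_ind => [|x y IHx IHy|b z].
  + by rewrite rmorph0 l0 rmorph0.
  + by rewrite rmorphD !lD rmorphD IHx IHy.
  + by rewrite tens_mapl_pure !lE rmorphMz.
Qed.

Section RhoExtension.
Variables (p : nat) (p_prime : prime p) (D : cyclo_data p).
Variables (E : comPzRingType) (s : {rmorphism E -> E}) (X : rho_extension D s).
Local Notation il := (re_inl X).
Local Notation j := (re_inr X).
Local Notation t := (re_tau X).
Local Notation sg := (re_sigma X).
Local Notation l := (re_coef X).
Let p_gt0 := prime_gt0 p_prime.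
Let p_gt1 := prime_gt1 p_prime.

Lemma re_inl_inj : injective il.
Proof.
move=> a b; have H c : l (il c) = c by rewrite -[il c]mulr1 re_coefZ re_coef1 mulr1.
by move/(congr1 l); rewrite !H.
Qed.

Lemma re_ext (B : comPzRingType) (f g : {rmorphism X -> B}) :
  (forall a, f (il a) = g (il a)) -> f (j (rho p)) = g (j (rho p)) -> f =1 g.
Proof.
move=> fgl fgr x; have [n [c ->]] := re_expand x; rewrite !rmorph_sum.
by apply: eq_bigr => k _; rewrite !rmorphM !rmorphXn fgl fgr.
Qed.

Lemma re_sigma_tau x : sg (t x) = t (sg x).
Proof.
apply: (re_ext (f := GRing.RMorphism.clone _ _ (sg \o t) _)
  (g := GRing.RMorphism.clone _ _ (t \o sg) _)) => [a|] /=.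
  by rewrite re_tau_inl !re_sigma_inl re_tau_inl.
by rewrite re_tau_inr !re_sigma_inr re_tau_inr.
Qed.

Lemma re_tau_order x : iter p.-1 t x = x.
Proof.
apply: (re_ext (f := GRing.RMorphism.clone _ _ (iter p.-1 t) _) (g := idfun)) => [a|] /=.
  by elim: p.-1 => //= n ->; apply: re_tau_inl.
by rewrite (iter_commute _ (re_tau_inr X)) tau_order.
Qed.

Lemma re_sigma_order k : (forall a, iter k s a = a) -> forall x, iter k sg x = x.
Proof.
move=> sk; apply: (re_ext (f := GRing.RMorphism.clone _ _ (iter k sg) _) (g := idfun)) => [a|] /=.
  by rewrite (iter_commute _ (re_sigma_inl X)) sk.
by elim: k {sk} => //= n ->; apply: re_sigma_inr.
Qed.

(* The trace of [rho] is -1 and the other traces of powers of [rho] are integers,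
   so applying the trace to [rho * x] expresses a fixed [x] through [E]. *)
Lemma re_tau_fixed x : t x = x -> exists a, x = il a.
Proof.
move=> tx; have [n [c xE]] := re_expand x.
have trj k : exists m : int, ctrace p.-1 t (j (rho p ^+ k)) = m%:~R.
  have -> : ctrace p.-1 t (j (rho p ^+ k)) = j (\sum_(i < p.-1) rho p ^+ (k * ns D ^ i)).
    rewrite rmorph_sum; apply: eq_bigr => i _.
    by rewrite (iter_commute _ (re_tau_inr X)) rmorphXn /= tau_iter_rho mulnC exprM.
  have [/dvdnP[q ->]|pk] := boolP (p %| k)%N; last first.
    by exists (-1); rewrite sum_rho_conj // rmorphN1 mulrN1z.
  exists p.-1%:Z; rewrite -pmulrn -(rmorph_nat j) -[X in _ = j X%:R](card_ord p.-1).
  rewrite -sumr_const; congr (j _); apply: eq_bigr => i _.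
  by rewrite mulnAC mulnC exprM rho_expp // expr1n.
have [m mE] := @choice nat int (fun k a => ctrace p.-1 t (j (rho p ^+ k)) = a%:~R) trj.
have xtr : - x = ctrace p.-1 t (x * j (rho p)).
  rewrite ctraceZ // (_ : ctrace _ _ _ = -1) ?mulrN1 //.
  rewrite -(rmorphN1 j) -(@sum_rho_conj p p_prime D 1) ?dvdn1 ?gtn_eqF // rmorph_sum.
  by apply: eq_bigr => i _; rewrite (iter_commute _ (re_tau_inr X)) tau_iter_rho mul1n.
exists (- \sum_(k < n) c k *~ m k.+1).
apply: oppr_inj; rewrite xtr rmorphN opprK {1}xE mulr_suml.
rewrite (big_morph (ctrace p.-1 t) (ctraceD p.-1 t) (_ : _ = 0)); last first.
  by rewrite /ctrace big1 // => k _; rewrite rmorph0.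
rewrite rmorph_sum; apply: eq_bigr => k _.
rewrite -mulrA -rmorphM -exprSr ctraceZ; last exact: re_tau_inl.
by rewrite mE rmorphMz mulrzr.
Qed.

End RhoExtension.

Lemma fixed_lift (A B : comPzRingType) (f : {rmorphism B -> B})
    (h : {rmorphism A -> B}) : (forall x, f (h x) = h x) ->
  exists g : {rmorphism A -> fixed_ring f}, forall x, val (g x) = h x.
Proof.
move=> fh; have fhP x : h x \in fixed_pred f by rewrite unfold_in /fixed_pred fh.
have [|||g gE] := @rmorphism_of A (fixed_ring f) (fun x => FixedRing (fhP x)).
- by apply: val_inj; rewrite /= rmorph1.
- by move=> x y; apply: val_inj; rewrite /= rmorphD.
- by move=> x y; apply: val_inj; rewrite /= rmorphM.
by exists g => x; rewrite gE.
Qed.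

Lemma prod_iter_fixed (A : comPzRingType) (f : {rmorphism A -> A}) n (x : A) :
  iter n f x = x -> f (\prod_(k < n) iter k f x) = \prod_(k < n) iter k f x.
Proof.
move=> fx; rewrite rmorph_prod; case: n fx => [|n] fx; first by rewrite !big_ord0.
rewrite big_ord_recr big_ord_recl /= mulrC; congr (_ * _).
by rewrite -iterS fx.
Qed.

(** * A Kummer generator over a semilocal base *)

Section SemilocalGenerator.
Variables (p : nat) (p_prime : prime p) (D : cyclo_data p).
Variables (R1 : comPzRingType) (R1_semilocal : semilocal R1).
Variables (S1 : cyclic_alg R1) (galS1 : is_Galois p S1).
Variable X : rho_extension D (ca_act S1).
Local Notation il := (re_inl X).
Local Notation j := (re_inr X).
Local Notation t := (re_tau X).
Local Notation sg := (re_sigma X).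
Local Notation l := (re_coef X).
Local Notation i := (ca_struct S1).
Local Notation F := (fixed_ring sg).
Let p_gt0 := prime_gt0 p_prime.
Let p_gt1 := prime_gt1 p_prime.
Let p1_gt0 : (0 < p.-1)%N. Proof. by rewrite -subn1 subn_gt0. Qed.

Let vF : {rmorphism F -> X} := GRing.RMorphism.clone _ _ (val : F -> X) _.
Let tF : {rmorphism F -> F} :=
  GRing.RMorphism.clone _ _ (fixed_morph (re_sigma_tau (X := X))) _.
Let FX : cyclic_alg F := @CyclicAlg F X vF sg (@fixed_ringP _ sg).

Let tF_iter k x : val (iter k tF x) = iter k t (val x).
Proof. by elim: k => //= k ->. Qed.

Let tF_order x : iter p.-1 tF x = x.
Proof. by apply: val_inj; rewrite tF_iter re_tau_order. Qed.

Lemma re_Galois : is_Galois p FX.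
Proof.
have [sp _ _ [w dw]] := galS1; split.
- exact: re_sigma_order.
- exact: val_inj.
- move=> x sx; have px : x \in fixed_pred sg by rewrite unfold_in /fixed_pred; apply/eqP.
  by exists (FixedRing px).
- exists [seq (il xy.1, il xy.2) | xy <- w] => k kp.
  rewrite big_map -(rmorph_nat il) -dw // rmorph_sum; apply: eq_bigr => xy _.
  by rewrite rmorphM (iter_commute k (re_sigma_inl X)).
Qed.

(* [I] consists of the [x] whose multiples all have their coefficient of 1 in [M];
   it contains [M] but not 1. *)
Lemma maximal_ideal_over (e : {rmorphism R1 -> F}) (M : R1 -> Prop) :
  (forall r, val (e r) = il (i r)) -> is_maximal_ideal M ->
  exists N, is_maximal_ideal N /\ forall r, M r -> N (e r).
Proof.
have [_ inji fixE _] := galS1.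
move=> eE maxM; have idM := maximal_is_ideal maxM.
pose I (x : F) := forall y : F, exists2 r, M r & l (val (x * y)) = i r.
have [||N [maxN IN]] := @maximal_ideal_above F I; last first.
- exists N; split=> // r Mr; apply: IN => y.
  (* The coefficient of a [sigma]-fixed element is fixed by the action on [S1], hence comes from
     [R1]; so the multiples of [e r] have their coefficient in [M]. *)
  have [|r' r'E] := fixE (l (val y)).
    by rewrite -re_coef_sigma; congr l; apply: fixed_ringP.
  exists (r * r'); first exact: (ideal_mulr idM).
  have -> : val (e r * y) = il (i r) * val y by rewrite -eE.
  by rewrite re_coefZ r'E rmorphM.
- case/(_ 1) => r Mr; rewrite mulr1 rmorph1 re_coef1 -(rmorph1 i) => /inji r1.
  by case: maxM => _ + _; rewrite r1.
- have l0 : l 0 = 0 by apply: (addrI (l 0)); rewrite -re_coefD !addr0.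
  split=> [y|x x' Ix Ix' y|a x Ix y].
  + by exists 0; [exact: (ideal0 idM) | rewrite mul0r !rmorph0 l0].
  + have [[r Mr rE] [r' Mr' r'E]] := (Ix y, Ix' y).
    exists (r + r'); first exact: (idealD idM).
    by rewrite mulrDl !rmorphD re_coefD rE r'E.
  + by have [r Mr rE] := Ix (a * y); exists r; rewrite // -rE mulrCA mulrA.
Qed.

(** Above each maximal ideal of [R1] choose one of [F], and make [c = (1 + x0 eta)^p] avoid it
    together with its conjugates under [tau]. The norm of [c] then lies in no maximal ideal of
    [R1]. *)
Lemma semilocal_generator : exists x0 : X,
  is_unit (1 + x0 * j (Defs.eta p)) /\ sg x0 = j (Defs.rho p) * x0 + 1.
Proof.
have [_ inji fixE _] := galS1.
have [|e eE] := @fixed_lift _ _ sg (GRing.RMorphism.clone _ _ (il \o i) _).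
  by move=> r; rewrite /= re_sigma_inl ca_act_struct.
have [|jF jFE] := @fixed_lift _ _ sg j; first exact: re_sigma_inr.
have [n [M semiM]] := R1_semilocal.
have [N NP] : exists N : 'I_n -> F -> Prop, forall a, is_maximal_ideal (M a) ->
    is_maximal_ideal (N a) /\ forall r, M a r -> N a (e r).
  have [|N NP] := @choice _ _ (fun a (N : F -> Prop) => is_maximal_ideal (M a) ->
    is_maximal_ideal N /\ forall r, M a r -> N (e r)); last by exists N.
  move=> a; have [maxM|nM] := pselect (is_maximal_ideal (M a)).
    by have [N NP] := maximal_ideal_over eE maxM; exists N.
  by exists (fun=> True).
pose N' (ak : 'I_n * 'I_p.-1) (x : F) := N ak.1 (iter ak.2 tF x).
have [|||th [c [sth thc Nc]]] := @eigen_avoid p p_gt0 F FX re_Galois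
    (jF (Defs.eta p)) (jF (Defs.rho p)) _ _ _ _ N' (enum {: 'I_n * 'I_p.-1}).
- by rewrite -(rmorph1 jF) -rmorphD addrC subrK.
- by under eq_bigr do rewrite -rmorphXn; rewrite -rmorph_sum sum_rho // rmorph0.
- move=> N0 maxN0; rewrite -(rmorph_nat jF) (xiE D) rmorphM rmorphXn.
  case/(maximal_mul maxN0) => [N0xi|]; last exact: maximal_exp.
  have [y xy] := xi_unit D; have [idN N01 _] := maxN0; case: N01.
  by rewrite -(rmorph1 jF) -xy rmorphM; apply: (ideal_mulr idN).
exists th; split; last by rewrite sth /= jFE.
(* The norm [nc] is fixed by [tau], hence comes from [S1], and by [sigma], hence from [R1]. *)
pose nc := \prod_(k < p.-1) iter k tF c.
have [a aE] : exists a, val nc = il a.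
  apply: (re_tau_fixed p_prime); rewrite -[t _]/(val (tF nc)).
  by rewrite /nc prod_iter_fixed.
have [|r rE] := fixE a.
  apply: (@re_inl_inj _ _ _ _ X); rewrite -re_sigma_inl -aE; exact: fixed_ringP.
have ncE : nc = e r by apply: val_inj; rewrite aE eE /= rE.
have ur : is_unit r.
  apply: is_unit_maximal => M0 maxM0 M0r; have [b M0b] := semiM M0 maxM0.
  have M0E : M0 = M b by apply/funext => x; apply/propext.
  rewrite M0E in maxM0 M0r; have [maxN MN] := NP b maxM0.
  move: (MN r M0r); rewrite -ncE; apply: (maximal_prod maxN) => k _.
  apply: (Nc (b, k)); first by rewrite mem_enum.
  apply: (@maximal_preim _ _ (iter k tF) (iter (p.-1 - k) tF)) maxN => x.
  by rewrite [LHS]/= -iterD subnKC ?tF_order // ltnW.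
have : is_unit (vF c).
  apply: rmorph_is_unit; have : is_unit nc by rewrite ncE; apply: rmorph_is_unit.
  by rewrite /nc (bigD1 (Ordinal p1_gt0)) //=; apply: is_unitMl.
rewrite -[vF c]thc /= jFE; exact: is_unitX_inv.
Qed.

End SemilocalGenerator.

(** * Descent of dual families along tau *)

(** Modulo [I], [f = -1] gives [c q' = (-f)^n = 1], whereas the square of [c q'] is 0. *)
Lemma ideal_one_unipotent (A : comPzRingType) (I : A -> Prop) (f q c : A) n :
  is_ideal I -> I (1 + f) -> f ^+ n = c * q -> I (c ^+ 2) -> I 1.
Proof.
move=> idI If fq Ic; pose q' := (-1) ^+ n * q.
have q'E : (- f) ^+ n = c * q' by rewrite -mulN1r exprMn fq mulrCA.
have I1 : I (1 - c * q').
  have -> : 1 - c * q' = (1 + f) * \sum_(i < n) (- f) ^+ i.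
    by rewrite -[c * q']q'E -opprB subrX1 -mulNr opprB opprK.
  exact: (ideal_mulr idI).
have -> : 1 = (1 - c * q') * (1 + c * q') + c ^+ 2 * q' ^+ 2 by ring.
by apply: (idealD idI); apply: (ideal_mulr idI).
Qed.

Section DualFamilies.
Variables (A : comPzRingType) (s : {rmorphism A -> A}).

(** The image of [w], read as an element of [A (x) A], under the ring morphism
    [x (x) y |-> x s^k(y)]; hence the multiplicativity below. *)
Let cof k (w : seq (A * A)) := \sum_(xy <- w) xy.1 * iter k s xy.2.

Lemma dual_family_mul (w v : seq (A * A)) : exists u, forall k, cof k u = cof k w * cof k v.
Proof.
exists [seq (x.1 * y.1, x.2 * y.2) | x <- w, y <- v] => k.
rewrite /cof big_allpairs_dep mulr_suml; apply: eq_bigr => x _.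
rewrite mulr_sumr; apply: eq_bigr => y _; rewrite rmorphM /=; ring.
Qed.

Definition diff_ideal k (x : A) :=
  exists w : seq (A * A), x = \sum_(xy <- w) xy.1 * (iter k s xy.2 - xy.2).

Lemma diff_ideal_ideal k : is_ideal (diff_ideal k).
Proof.
split; first by exists [::]; rewrite big_nil.
  by move=> x y [w ->] [v ->]; exists (w ++ v); rewrite big_cat.
move=> a x [w ->]; exists [seq (a * xy.1, xy.2) | xy <- w].
by rewrite big_map mulr_sumr; apply: eq_bigr => xy _; rewrite mulrA.
Qed.

Lemma diff_idealP k y : diff_ideal k (iter k s y - y).
Proof. by exists [:: (1, y)]; rewrite big_seq1 mul1r. Qed.

(** By induction, the family found for smaller indices is multiplied by one with [cof 0 = 1] and
    [cof n = 0]. *)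
Lemma dual_family_exists p :
  (forall k, (0 < k < p)%N -> diff_ideal k 1) -> exists w, dual_family p s w.
Proof.
move=> J; suff [w [w0 wS]] : exists w, cof 0 w = 1 /\
    forall k, (0 < k < p)%N -> cof k w = 0.
  by exists w => k kp; have [->|k0] := eqVneq k 0%N; rewrite // -/(cof _ _) wS // lt0n k0.
have [n np] : exists n, (p <= n)%N by exists p.
suff [w [w0 wS]] : exists w, cof 0 w = 1 /\
    forall k, (0 < k < p)%N -> (k < n)%N -> cof k w = 0.
  by exists w; split=> // k kp; apply: wS => //; case/andP: kp => _ /leq_trans->.
elim: n {np} => [|n [w [w0 wS]]].
  by exists [:: (1, 1)]; split=> //; rewrite /cof big_seq1 mul1r.
have [np|np] := boolP (0 < n < p)%N; last first.
  exists w; split=> // k kp; rewrite ltnS leq_eqVlt => /predU1P[kn|]; last exact: wS.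
  by rewrite kn (negPf np) in kp.
have [v vE] := J n np.
(* From [1 = sum x (s^n y - y)] comes the element [(sum x s^n y) (x) 1 - sum x (x) y], whose [cof k]
   is [sum x (s^n y - s^k y)]: it is 1 at [k = 0] and 0 at [k = n]. *)
have [u uE] := dual_family_mul w
  ((\sum_(xy <- v) xy.1 * iter n s xy.2, 1) :: [seq (- xy.1, xy.2) | xy <- v]).
have cofv k : cof k ((\sum_(xy <- v) xy.1 * iter n s xy.2, 1) ::
    [seq (- xy.1, xy.2) | xy <- v])
    = \sum_(xy <- v) xy.1 * (iter n s xy.2 - iter k s xy.2).
  rewrite /cof big_cons rmorph1 mulr1 big_map -big_split; apply: eq_bigr => xy _ /=.
  by rewrite mulrBr mulNr.
exists u; split=> [|k kp]; first by rewrite uE w0 cofv mul1r.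
rewrite uE ltnS leq_eqVlt => /predU1P[->|kn]; last by rewrite wS ?mul0r.
by rewrite cofv [X in _ * X]big1 ?mulr0 // => xy _; rewrite subrr mulr0.
Qed.

End DualFamilies.

Section Descent.
Variables (p : nat) (p_prime : prime p) (D : cyclo_data p).
Variables (S : comPzRingType) (tfS : torsion_free p S).
Variables (j : {rmorphism Zrho p -> S}) (t sg : {rmorphism S -> S}) (th : S).
Hypothesis tj : forall z, t (j z) = j (tau0 D z).
Hypothesis sj : forall z, sg (j z) = j z.
Hypothesis ts : forall x, t (sg x) = sg (t x).
Hypothesis tp : forall x, iter p.-1 t x = x.
Hypothesis sth : sg th = j (Defs.rho p) * th + 1.
Hypothesis uth : is_unit (1 + th * j (Defs.eta p)).
Local Notation rho := (Defs.rho p).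
Local Notation eta := (Defs.eta p).
Local Notation F := (fixed_ring t).
Local Notation sF := (fixed_morph (f := t) (g := t) (h := sg) ts).
Local Notation Tr := (ctrace p.-1 t).
Let p_gt0 := prime_gt0 p_prime.
Let p_gt1 := prime_gt1 p_prime.
Let p1_gt0 : (0 < p.-1)%N. Proof. by rewrite -subn1 subn_gt0. Qed.

Lemma ctrace_tau_fixed x : Tr x \in fixed_pred t.
Proof. by rewrite unfold_in /fixed_pred ctrace_fix. Qed.

Definition trF x : F := FixedRing (ctrace_tau_fixed x).

Lemma ctrace_rho : Tr (j rho) = -1.
Proof.
rewrite -(rmorphN1 j) -(@sum_rho_conj p p_prime D 1) ?dvdn1 ?gtn_eqF // rmorph_sum.
by apply: eq_bigr => i _; rewrite (iter_commute i tj) tau_iter_rho mul1n.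
Qed.

(** Every conjugate of [eta] is a multiple of [eta]. *)
Lemma ctrace_eta x : exists y, Tr (j eta * x) = j eta * y.
Proof.
exists (\sum_(i < p.-1) j (\prod_(k < i) iter k (tau0 D) (delta D)) * iter i t x).
rewrite mulr_sumr; apply: eq_bigr => i _.
rewrite rmorphM /= (iter_commute i tj) iter_tau_eta // rmorphM; ring.
Qed.

(* Only the term [i = 0] of the trace survives the sum over [m], because
   [tau^i rho <> rho] for [0 < i < p - 1]. *)
Lemma trace_inversion x :
  \sum_(m < p) j rho ^+ (p.-1 * m) * Tr (j rho ^+ m * x) = p%:R * x.
Proof.
transitivity (\sum_(i < p.-1) (\sum_(m < p) j ((rho ^+ (p.-1 + ns D ^ i)) ^+ m)) * iter i t x).
  under eq_bigr do rewrite mulr_sumr.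
  rewrite exchange_big; apply: eq_bigr => i _; rewrite mulr_suml; apply: eq_bigr => m _.
  rewrite rmorphM rmorphXn /= (iter_commute i tj) tau_iter_rho mulrA; congr (_ * _).
  by rewrite -!(rmorphXn j) -(rmorphM j) -!exprM -exprD mulnDl.
rewrite (bigD1 (Ordinal p1_gt0)) //= [X in _ + X]big1 => [|i i0].
  rewrite addr0; congr (_ * _).
  rewrite (eq_bigr (fun=> 1)) ?sumr_const ?card_ord // => m _.
  by rewrite expn0 addn1 prednK // rho_expp // expr1n rmorph1.
rewrite -rmorph_sum rho_power_sum ?rmorph0 ?mul0r //.
apply: contra i0 => /dvdnP[q qE]; apply/eqP/val_inj; apply: (@expns_eq1 p p_prime D) => //=.
have : (p.-1 + ns D ^ i + 1 = p.-1 + 1 + ns D ^ i)%N by rewrite addnAC.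
rewrite qE addn1 [(p.-1 + 1)%N]addn1 prednK // => /(congr1 (modn^~ p)).
by rewrite -addn1 modnMDl modnDl => <-.
Qed.

Let a := 1 + th * j eta.

Lemma sigma_iter_unit k : iter k sg a = j rho ^+ k * a.
Proof.
elim: k => [|k IH]; first by rewrite mul1r.
rewrite iterS IH rmorphM rmorphXn sj exprSr -mulrA; congr (_ * _).
rewrite /a rmorphD rmorph1 rmorphM sth sj /Defs.eta rmorphB rmorph1; ring.
Qed.

Lemma sigma_iter_theta k : iter k sg th = fg_add (j eta) th (fg_muln (j eta) k 1).
Proof.
have H x : fg_add (j eta) x 1 = j rho * x + 1.
  by rewrite /fg_add /Defs.eta rmorphB rmorph1; ring.
have s1 n : iter n sg (1 : S) = 1 by exact: rmorph1.
elim: k => [|k IH]; first by rewrite fg_addC fg_add0.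
rewrite iterSr sth -H (rmorph_fg_add (GRing.RMorphism.clone _ _ (iter k sg) _)) /=.
have -> : iter k sg (j eta) = j eta by elim: (k) => //= n ->.
by rewrite s1 IH -fg_addA; congr fg_add; apply: fg_addC.
Qed.

(** Let [c m = Tr(rho^m a)]. By [trace_inversion], [p (rho^k - 1) a] is a combination over [S] of
    the differences of the [c m]. Multiplied by [w] it becomes [- p^2 rho], and taking the trace,
    with [Tr(rho) = -1], brings the coefficients into the fixed ring. *)
Lemma diff_ideal_p2 k : (0 < k < p)%N -> diff_ideal sF k (p%:R ^+ 2).
Proof.
move=> /andP[k0 kp]; have idJ := diff_ideal_ideal sF k.
have pk : ~~ (p %| k)%N by rewrite gtnNdvd.
have [q qE] := dvd_rho_sub1_eta p_prime pk.
have [b ab] := uth.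
have jq : (j rho ^+ k - 1) * j q = j eta by rewrite -qE rmorphM rmorphB rmorphXn rmorph1.
pose q' := xi D * eta ^+ p.-2.
have jp : p%:R = j eta * j q' by rewrite -rmorphM eta_dvdp // rmorph_nat.
(* [rho^k - 1] divides [eta], hence [p], and [a] is a unit. *)
pose w := - (b * j q * j q' * j rho).
have wE : w * ((j rho ^+ k - 1) * a) = - (p%:R * j rho).
  rewrite jp -jq -[RHS]mulr1 -ab /w /a; ring.
pose c m := trF (j rho ^+ m * a).
have sF_iter m x : val (iter m sF x) = iter m sg (val x).
  by elim: m => //= m ->.
have sTr x : iter k sg (Tr x) = Tr (iter k sg x).
  rewrite rmorph_sum; apply: eq_bigr => i _.
  apply: (@iter_commute _ _ sg sg (iter i t)) => y; exact/esym/(iter_commute i ts).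
have vc m : val (iter k sF (c m) - c m) = Tr (j rho ^+ m * (j rho ^+ k * a)) - Tr (j rho ^+ m * a).
  rewrite rmorphB /= sF_iter /= sTr rmorphM /= sigma_iter_unit rmorphXn /=.
  by congr (Tr (_ ^+ _ * _) - _); elim: (k) => //= n ->; apply: sj.
have -> : p%:R ^+ 2 = \sum_(m < p) trF (w * j rho ^+ (p.-1 * m)) * (iter k sF (c m) - c m).
  apply: val_inj; rewrite rmorph_sum rmorphXn rmorph_nat /=.
  transitivity (Tr (w * (p%:R * ((j rho ^+ k - 1) * a)))).
    rewrite mulrCA wE mulrN mulrA -mulNr ctraceZ; last by rewrite rmorphN rmorphM rmorph_nat.
    by rewrite ctrace_rho mulrN1 opprK.
  rewrite mulrBl mul1r mulrBr -!trace_inversion -sumrB mulr_sumr.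
  rewrite (big_morph Tr (ctraceD p.-1 t) (_ : _ = 0)); last first.
    by rewrite /ctrace big1 // => m _; rewrite rmorph0.
  apply: eq_bigr => m _; rewrite -mulrBr -vc mulrA [X in Tr X]mulrC.
  apply: etrans (ctraceZ _ _ (fixed_ringP (iter k sF (c m) - c m))) _.
  exact: mulrC.
apply: (ideal_sum idJ) => m _; apply: (ideal_mull idJ); exact: diff_idealP.
Qed.

(* [d] is the image of the trace of [th] under [sg^k - 1]; it is congruent to
   [(p - 1) k] modulo [eta]. *)
Lemma diff_ideal_unipotent k : (0 < k < p)%N -> exists f q : F,
  diff_ideal sF k (1 + f) /\ f ^+ p.-1 = p%:R * q.
Proof.
move=> /andP[k0 kp]; have idJ := diff_ideal_ideal sF k.
have pk : ~~ (p %| k)%N by rewrite gtnNdvd.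
pose d := iter k sF (trF th) - trF th.
have [n [m nm]] : exists n m, (n * (k * p.-1) = 1 + m * p)%N.
  have pm : ~~ (p %| k * p.-1)%N by rewrite Euclid_dvdM // negb_or pk gtnNdvd ?ltn_predL.
  have m0 : (0 < k * p.-1)%N by case: (_ * _)%N pm => //; rewrite dvdn0.
  have [n m e _] := egcdnP p m0; exists n, m.
  by rewrite e (eqP (_ : coprime _ p)) 1?addnC // coprime_sym prime_coprime.
have [g gE] : exists g, fg_muln (j eta) k 1 = k%:R + j eta * g.
  elim: k {k0 kp pk d idJ nm} => [|k [g IH]]; first by exists 0; rewrite mulr0 addr0.
  exists (g + fg_muln (j eta) k 1); rewrite fg_mulnS /fg_add {1}IH mul1r -natr1; ring.
have Trnat (l : nat) : Tr l%:R = (l * p.-1)%:R.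
  rewrite /ctrace (eq_bigr (fun=> l%:R)) => [|i _]; last exact: rmorph_nat.
  by rewrite sumr_const card_ord -mulrnA.
have sTr x : iter k sg (Tr x) = Tr (iter k sg x).
  rewrite rmorph_sum; apply: eq_bigr => i _.
  apply: (@iter_commute _ _ sg sg (iter i t)) => y; exact/esym/(iter_commute i ts).
have [h hE] : exists h, val d = (k * p.-1)%:R + j eta * h.
  have -> : val d = iter k sg (Tr th) - Tr th.
    by rewrite /d rmorphB /=; congr (_ - _); elim: (k) => //= l ->.
  have [h hE] := ctrace_eta (g + th * fg_muln (j eta) k 1).
  exists h; rewrite -hE -Trnat sTr sigma_iter_theta -ctraceD; apply/eqP.
  rewrite subr_eq -ctraceD; apply/eqP; congr (ctrace _ _ _).
  by rewrite /fg_add {1}gE; ring.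
(* As [n k (p - 1) = 1 + m p], [f] is divisible by [eta] in [S]. *)
pose f : F := n%:R * d - 1.
pose q' := xi D * eta ^+ p.-2.
have jp : p%:R = j eta * j q' by rewrite -rmorphM eta_dvdp // rmorph_nat.
have [h' fE] : exists h', val f = j eta * h'.
  have fd : val f = n%:R * val d - 1 by rewrite /f rmorphB rmorphM rmorph_nat rmorph1.
  exists (j q' * m%:R + n%:R * h); rewrite fd hE mulrDr -natrM nm natrD natrM jp; ring.
have [x xx] := xi_unit D.
pose q := j x * h' ^+ p.-1.
have qE : p%:R * q = val f ^+ p.-1.
  rewrite fE exprMn /q -(rmorph_nat j) (xiE D) rmorphM rmorphXn -[RHS]mulr1.
  rewrite -(rmorph1 j) -xx rmorphM; ring.
(* [p q] is fixed and [S] has no [p]-torsion. *)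
have qF : q \in fixed_pred t.
  rewrite unfold_in /fixed_pred -subr_eq0; apply/eqP/tfS.
  rewrite -mulr_natl mulrBr -[in p%:R * t q](rmorph_nat t) -rmorphM qE rmorphXn.
  by rewrite fixed_ringP subrr.
exists f, (FixedRing qF); split.
  rewrite /f addrC subrK; apply: (ideal_mull idJ); exact: diff_idealP.
by apply: val_inj; rewrite rmorphXn rmorphM rmorph_nat /= qE.
Qed.

Lemma descended_dual_family : exists w, dual_family p sF w.
Proof.
apply: dual_family_exists => k kp; have idJ := diff_ideal_ideal sF k.
have Jp2 := diff_ideal_p2 kp; have [f [q [Jf fq]]] := diff_ideal_unipotent kp.
exact: (ideal_one_unipotent idJ Jf fq Jp2).
Qed.

End Descent.

(** * The generic extension and its specializations *)

(** Iterating the relation [p - 1] times gives [a^(s^(p-1)) = t^(p-1)(a) (a^p)^r]; since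
    [s^(p-1) = p r + 1], the unit [a^(p r)] cancels. *)
Lemma twisted_root_order (p : nat) (D : cyclo_data p) (S : comPzRingType)
    (t : {rmorphism S -> S}) (a b : S) :
  is_unit a -> a ^+ ns D = t a * b ^+ nr D ->
  a ^+ p = \prod_(i < p.-1) iter i t b ^+ (ns D ^ (p - 2 - i)) ->
  iter p.-1 t a = a.
Proof.
move=> ua ta ap.
have H i : a ^+ (ns D ^ i) =
    iter i t a * (\prod_(k < i) iter k t b ^+ (ns D ^ (i.-1 - k))) ^+ nr D.
  elim: i => [|i IH]; first by rewrite big_ord0 expr1n mulr1.
  rewrite expnSr exprM IH exprMn -rmorphXn ta rmorphM /= -iterS iterSr -mulrA.
  congr (_ * _); rewrite -exprM mulnC exprM -prodrXl big_ord_recr /= subnn expr1.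
  rewrite exprMn mulrC rmorphXn; congr (_ ^+ _ * _); apply: eq_bigr => k _.
  have i0 : (0 < i)%N by apply: leq_ltn_trans (ltn_ord k).
  by rewrite -exprM -expnSr -subSn ?prednK // -ltnS prednK.
have := H p.-1; rewrite (nsE D) exprS exprM ap.
have -> : \prod_(k < p.-1) iter k t b ^+ (ns D ^ (p.-1.-1 - k))
    = \prod_(k < p.-1) iter k t b ^+ (ns D ^ (p - 2 - k)).
  by apply: eq_bigr => k _; rewrite -subn2.
rewrite -ap -exprM => /esym/is_unit_mulIr; apply; exact: is_unitX.
Qed.

Lemma rmorph1DM (A B : comPzRingType) (f : {rmorphism A -> B}) x y :
  f (1 + x * y) = 1 + f x * f y.
Proof. by rewrite rmorphD rmorph1 rmorphM. Qed.

Lemma iter_rmorph1DM (A : comPzRingType) (f : {rmorphism A -> A}) k x y :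
  iter k f (1 + x * y) = 1 + iter k f x * iter k f y.
Proof. exact: (rmorph1DM (GRing.RMorphism.clone _ _ (iter k f) _)). Qed.

Lemma mulrn_expS (A : comPzRingType) (e c x : A) m n : e * c = m%:R ->
  x *+ (m ^ n.+1) = c ^+ n * (e ^+ n * (m%:R * x)).
Proof. by move=> ec; rewrite -[LHS]mulr_natl natrX -ec exprSr exprMn; ring. Qed.

Section Generic.
Variables (p : nat) (p_prime : prime p) (D : cyclo_data p) (G : generic_ext D).
Local Notation rho := (Defs.rho p).
Local Notation eta := (Defs.eta p).
Local Notation R := (gR G).
Local Notation loc := (gloc G).
Local Notation S := (Sring D (gloc G)).
Local Notation inc := (inc D (gloc G)).
Local Notation th := (theta D (gloc G)).
Local Notation t := (gtau G).
Local Notation sg := (gsigma G).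
Local Notation cst := (@Defs.cst p).
Let p_gt0 := prime_gt0 p_prime.
Let p_gt1 := prime_gt1 p_prime.
Let hm := mk_monic_hpoly D (gloc G) p_prime.

Definition jS : {rmorphism Zrho p -> S} :=
  GRing.RMorphism.clone _ _ (inc \o (loc \o cst)) _.

Definition zS : S := inc (loc (zP p)).

Lemma torsion_free_R : torsion_free p R.
Proof. exact/(torsion_free_localization (glocP G))/torsion_free_mpoly/torsion_free_Zrho. Qed.

Lemma torsion_free_S : torsion_free p S.
Proof. exact/torsion_free_qpoly/torsion_free_R. Qed.

Lemma tau_inc_loc f : t (inc (loc f)) = inc (loc (tauP D f)).
Proof. by rewrite gtau_inc gtauRE. Qed.

Lemma tau_jS z : t (jS z) = jS (tau0 D z).
Proof. by rewrite /jS /= tau_inc_loc /= map_mpolyC. Qed.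

Lemma sigma_jS z : sg (jS z) = jS z.
Proof. exact: gsigma_inc. Qed.

Lemma normPE f : normP D f
  = tnorm D (tauP D) (cst (eta ^+ p)) (cst (delta D ^+ p)) f.
Proof. by []. Qed.

Lemma inc_loc_normP : inc (loc (normP D (zP p)))
  = tnorm D t (jS eta ^+ p) (jS (delta D) ^+ p) zS.
Proof.
rewrite normPE; have := @rmorph_tnorm p D _ _
  (GRing.RMorphism.clone _ _ (inc \o loc) _) (tauP D) t
  (cst (eta ^+ p)) (cst (delta D ^+ p)) (zP p) tau_inc_loc.
by move=> /= ->; rewrite -!rmorphXn.
Qed.

Lemma isog_theta_hpoly (B : comPzRingType) (F : {rmorphism {poly R} -> B})
    (j : {rmorphism Zrho p -> B}) : (forall z, F (loc (cst z))%:P = j z) ->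
  F (hpoly D (gloc G)) = isog D j (F 'X) - F (loc (normP D (zP p)))%:P.
Proof.
move=> Fj; rewrite /hpoly rmorphB rmorphD rmorphXn; congr (_ + _ - _).
rewrite /gpoly map_polyZ -mul_polyC rmorphM /= Fj !rmorph_sum; congr (_ * _).
apply: eq_big_nat => i _.
by rewrite /= map_polyZ map_polyXn -mul_polyC (rmorphM F) Fj rmorphM rmorph_nat !rmorphXn.
Qed.

Lemma isog_theta : isog D jS th = inc (loc (normP D (zP p))).
Proof.
have := @isog_theta_hpoly S (in_qpoly (hpoly D (gloc G))) jS
  (fun z => @in_qpolyC R (hpoly D (gloc G)) (loc (cst z))).
rewrite /= in_qpoly_mod // in_qpolyC => /esym/eqP; rewrite subr_eq0 => /eqP; exact.
Qed.

Let a := 1 + th * jS eta.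
Let b := 1 + zS * jS eta ^+ p.

Lemma tau_jS_etap : t (jS eta ^+ p) = jS (delta D) ^+ p * jS eta ^+ p.
Proof. by rewrite rmorphXn tau_jS tau_eta rmorphM exprMn. Qed.

(** It is a factor of the image of the inverted element [C]. *)
Lemma is_unit_tau_b i : (i < p.-1)%N -> is_unit (iter i t b).
Proof.
move=> ip; have [uC _ _] := glocP G.
have : is_unit (inc (loc (CP D))) by apply: rmorph_is_unit.
rewrite /CP (bigD1 (Ordinal ip)) //= !rmorphM => /is_unitMl.
have -> : b = inc (loc (1 + zP p * cst (eta ^+ p))).
  pose f : {rmorphism PolyR p -> S} := GRing.RMorphism.clone _ _ (inc \o loc) _.
  rewrite -[RHS]/(f (1 + zP p * cst (eta ^+ p))) rmorph1DM.
  by rewrite /b -(rmorphXn jS).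
by rewrite (iter_commute i tau_inc_loc).
Qed.

Lemma theta_expp : a ^+ p = \prod_(i < p.-1) iter i t b ^+ (ns D ^ (p - 2 - i)).
Proof.
by rewrite -(one_isog p_prime D) isog_theta inc_loc_normP one_tnorm // tau_jS_etap.
Qed.

Lemma is_unit_theta : is_unit a.
Proof.
apply: (is_unitX_inv p_gt0); rewrite theta_expp.
by apply: is_unit_prod => i _; apply/is_unitX/is_unit_tau_b.
Qed.

Lemma ScstE z : Scst D loc z = jS z.
Proof. by []. Qed.

Lemma tau_theta : fg_muln (jS eta) (ns D) th
  = fg_add (jS eta) (fg_muln (jS eta ^+ p) (nr D) zS * jS eta ^+ p.-1)
      (jS (delta D) * t th).
Proof. by have [_] := gtau_theta G; rewrite !ScstE -!(rmorphXn jS). Qed.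

Lemma theta_expns : a ^+ ns D = t a * b ^+ nr D.
Proof.
rewrite -one_fg_muln tau_theta one_fg_add mulrC rmorph1DM tau_jS tau_eta (rmorphM jS).
congr (_ * _); first by congr (1 + _); rewrite mulrCA mulrA.
by rewrite -one_fg_muln -mulrA -exprSr prednK.
Qed.

Lemma tau_order_R x : iter p.-1 (gtauR G) x = x.
Proof.
apply: (localization_ext (glocP G)
  (F := GRing.RMorphism.clone _ _ (iter p.-1 (gtauR G)) _) (G := idfun)) => f /=.
rewrite (iter_commute _ (@gtauRE p D G)); congr (loc _).
apply: (mpoly_ext (F := GRing.RMorphism.clone _ _ (iter p.-1 (tauP D)) _) (G := idfun)) => [c|i] /=.
  have tc z : tauP D (mpolyC p.-1 z) = mpolyC p.-1 (tau0 D z) by apply: map_mpolyC.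
  by rewrite (iter_commute _ tc) tau_order.
by rewrite iter_fix //; apply: map_mpolyX.
Qed.

(** On [theta] the identity is checked for [1 + theta eta], by [twisted_root_order], and [eta] is
    then cancelled. *)
Lemma tau_order_S x : iter p.-1 t x = x.
Proof.
apply: (qpoly_ext (F := GRing.RMorphism.clone _ _ (iter p.-1 t) _) (G := idfun)) => [c|] /=.
  by rewrite (iter_commute _ (@gtau_inc p D G)) tau_order_R.
apply: (eta_inj p_prime D torsion_free_S (j := jS)); apply: (addrI 1).
rewrite ![jS eta * _]mulrC -[RHS](twisted_root_order is_unit_theta theta_expns theta_expp).
by rewrite /a iter_rmorph1DM (iter_commute _ tau_jS) tau_order.
Qed.

Lemma sigma_order_S x : iter p sg x = x.
Proof.
apply: (qpoly_ext (F := GRing.RMorphism.clone _ _ (iter p sg) _) (G := idfun)) => [c|] /=.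
  by rewrite iter_fix // gsigma_inc.
apply: (eta_inj p_prime D torsion_free_S (j := jS)); apply: (addrI 1).
have := sigma_iter_unit sigma_jS (gsigma_theta G) p.
rewrite -rmorphXn rho_expp // rmorph1 mul1r => e; rewrite ![jS eta * _]mulrC -[RHS]e.
by rewrite iter_rmorph1DM (@iter_fix _ _ _ (jS eta)) ?sigma_jS.
Qed.

(* The traces of the powers of [a] are in [R]; hence so are those of the
   [eta^i theta^i], and [p x], the trace of [x], is in [R] up to a power of [eta]. *)
Lemma sigma_fixed_S x : sg x = x -> exists r, x = inc r.
Proof.
move=> sx.
pose inR (y : S) := exists r, y = inc r.
have inRD y y' : inR y -> inR y' -> inR (y + y').
  by move=> [r ->] [r' ->]; exists (r + r'); rewrite rmorphD.
have inRM y y' : inR y -> inR y' -> inR (y * y').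
  by move=> [r ->] [r' ->]; exists (r * r'); rewrite rmorphM.
have inRj z : inR (jS z) by exists (loc (cst z)).
have inR_sum I (s : seq I) (F : I -> S) : (forall i, inR (F i)) -> inR (\sum_(i <- s) F i).
  by move=> FR; apply: big_ind => //; exists 0; rewrite rmorph0.
have tra m : inR (ctrace p sg (a ^+ m)).
  have trE : ctrace p sg (a ^+ m) = jS (\sum_(k < p) (rho ^+ m) ^+ k) * a ^+ m.
    rewrite rmorph_sum mulr_suml; apply: eq_bigr => k _; rewrite rmorphXn /=.
    rewrite (sigma_iter_unit sigma_jS (gsigma_theta G)) exprMn; congr (_ * _).
    by rewrite -!rmorphXn -!exprM mulnC.
  (* For [p] dividing [m], [a^m] is a power of [a^p = 1 + N(z) eta^p], which comes from [R]; for
     other [m] the powers of [rho^m] sum to 0. *)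
  rewrite trE; have [/dvdnP[q ->]|pm] := boolP (p %| m)%N; last first.
    by rewrite rho_power_sum // rmorph0 mul0r; exists 0; rewrite rmorph0.
  apply: (inRM); first exact: inRj.
  rewrite mulnC exprM -(one_isog p_prime D) isog_theta.
  elim: q => [|q IH]; first by exists 1; rewrite rmorph1.
  rewrite exprS; apply: (inRM) => //; apply: (inRD); first by exists 1; rewrite rmorph1.
  by apply: (inRM); [exists (loc (normP D (zP p))) | rewrite -rmorphXn; apply: (inRj)].
have trth m : inR (jS eta ^+ m * ctrace p sg (th ^+ m)).
  rewrite -ctraceZ; last by rewrite rmorphXn sigma_jS.
  have -> : jS eta ^+ m * th ^+ m = \sum_(k < m.+1) ((-1) ^+ (m - k) *+ 'C(m, k)) * a ^+ k.
    rewrite -exprMn (_ : jS eta * th = -1 + a); last by rewrite /a addKr mulrC.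
    by rewrite exprDn; apply: eq_bigr => k _; rewrite mulrnAl.
  rewrite (big_morph (ctrace p sg) (ctraceD p sg) (_ : _ = 0)); last first.
    by rewrite /ctrace big1 // => k _; rewrite rmorph0.
  apply: (inR_sum) => k; rewrite ctraceZ; last by rewrite rmorphMn rmorphXn rmorphN1.
  by apply: (inRM) => //; exists ((-1) ^+ (m - k) *+ 'C(m, k)); rewrite rmorphMn rmorphXn rmorphN1.
pose n := size (x : {poly R}).
have [r rE] : inR (jS eta ^+ n * (p%:R * x)).
  have -> : p%:R * x = ctrace p sg x.
    rewrite /ctrace (eq_bigr (fun=> x)); first by rewrite sumr_const card_ord mulr_natl.
    by move=> k _; rewrite iter_fix.
  rewrite [x in ctrace p sg x]qpoly_expand (big_morph (ctrace p sg) (ctraceD p sg) (_ : _ = 0)).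
    rewrite mulr_sumr; apply: (inR_sum) => i.
    rewrite ctraceZ; last exact: gsigma_inc.
    rewrite mulrCA; apply: (inRM); first by eexists.
    have -> : jS eta ^+ n = jS eta ^+ i * jS eta ^+ (n - i).
      by rewrite -exprD subnKC // ltnW.
    rewrite mulrAC; apply: (inRM); first exact: trth.
    by rewrite -rmorphXn; apply: (inRj).
  by rewrite /ctrace big1 // => k _; rewrite rmorph0.
have [r' r'E] : exists r', x *+ (p ^ n.+1) = inc r'.
  exists (loc (cst ((xi D * eta ^+ p.-2) ^+ n)) * r).
  rewrite rmorphM -rE -[inc (loc _)]/(jS _) rmorphXn.
  by apply: mulrn_expS; rewrite -rmorphM eta_dvdp // rmorph_nat.
(* [p^(n+1)] kills the coefficients of positive degree, and [R] has no [p]-torsion. *)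
exists ((x : {poly R})`_0); apply: val_inj; apply/polyP => i /=.
rewrite coefC; case: eqP => [->//|i0].
have tfpX m (y : R) : y *+ (p ^ m) = 0 -> y = 0.
  elim: m y => [|m IH] y; first by rewrite mulr1n.
  by rewrite expnSr mulrnA => /torsion_free_R/IH.
apply: (tfpX n.+1); have /= := congr1 (fun q : S => (q : {poly R})`_i) r'E.
by rewrite raddfMn coefMn coefC => ->; case: eqP i0.
Qed.

End Generic.

Lemma rmorphism_factor (A B C : comPzRingType) (k : {rmorphism A -> C})
    (h : {rmorphism B -> C}) : injective k -> (forall x, exists y, h x = k y) ->
  exists g : {rmorphism B -> A}, forall x, k (g x) = h x.
Proof.
move=> injk hk; have [g0 g0E] := choice hk.
have [|||g gE] := @rmorphism_of B A g0; last by exists g => x; rewrite gE g0E.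
- by apply: injk; rewrite -g0E !rmorph1.
- by move=> x y; apply: injk; rewrite rmorphD -!g0E rmorphD.
- by move=> x y; apply: injk; rewrite rmorphM -!g0E rmorphM.
Qed.

Lemma Stau_Galois (p : nat) (p_prime : prime p) (D : cyclo_data p)
  (G : generic_ext D) : is_Galois p (Stau G).
Proof.
have inc_inj : injective (inc D (gloc G)).
  move=> x y /(congr1 (fun q : Sring D (gloc G) => (q : {poly gR G})`_0)).
  by rewrite !coefC.
split.
- move=> x; apply: val_inj; rewrite -[RHS](sigma_order_S p_prime).
  exact/esym/(@iter_commute _ _ (ca_act (Stau G)) (gsigma G) val).
- by move=> x y /(congr1 val) /inc_inj; apply: val_inj.
- move=> x /(congr1 val) /(sigma_fixed_S p_prime)[r rE].
  have rP : r \in fixed_pred (gtauR G).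
    rewrite unfold_in; apply/eqP/inc_inj; rewrite -gtau_inc -rE; exact: fixed_ringP.
  by exists (FixedRing rP); apply: val_inj.
- have [w dw] := descended_dual_family p_prime (@torsion_free_S p p_prime D G)
    (@tau_jS p D G) (@sigma_jS p D G) (@gsigma_tau p D G)
    (@tau_order_S p p_prime D G) (gsigma_theta G) (@is_unit_theta p p_prime D G).
  by exists w.
Qed.

(** Reduced representatives have degree less than [p - 1], which leaves one coefficient for each
    variable of [PolyR]. *)
Lemma Zrho_expand_lt (p : nat) (p_prime : prime p) (x : Zrho p) :
  x = \sum_(i < p.-1) ((x : {poly int})`_i)%:~R * Defs.rho p ^+ i.
Proof.
have szx : (size (x : {poly int}) <= p.-1)%N.
  rewrite -ltnS prednK ?prime_gt0 // (leq_trans (size_mk_monic x)) //.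
  by rewrite mk_monic_cyclo_poly // cyclo_polyE size_poly.
rewrite [LHS]Zrho_expand.
rewrite (big_ord_widen _ (fun i => ((x : {poly int})`_i)%:~R * Defs.rho p ^+ i) szx).
rewrite big_mkcond; apply: eq_bigr => i _; case: ltnP => // /leq_sizeP -> //.
by rewrite mul0r.
Qed.

(** * Specialization of the generic extension *)

Section Specialization.
Variables (p : nat) (p_prime : prime p) (D : cyclo_data p) (G : generic_ext D).
Variables (R1 : comPzRingType) (S1 : cyclic_alg R1) (galS1 : is_Galois p S1).
Variable X : rho_extension D (ca_act S1).
Local Notation il := (re_inl X).
Local Notation j := (re_inr X).
Local Notation t := (re_tau X).
Local Notation sg := (re_sigma X).
Local Notation i := (ca_struct S1).
Local Notation rho := (Defs.rho p).
Local Notation eta := (Defs.eta p).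
Let p_gt0 := prime_gt0 p_prime.

(* The coefficients of a fixed element can be chosen in [R1]: multiply it by an
   element of trace 1 and take the trace. *)
Lemma re_sigma_fixed u : sg u = u ->
  exists c : nat -> R1, u = \sum_(k < p.-1) j (rho ^+ k) * il (i (c k)).
Proof.
move=> su; have [y y1] := Galois_trace_one p_gt0 galS1.
have [n [c uE]] := re_expand u.
have iltr x : ctrace p sg (il x) = il (ctrace p (ca_act S1) x).
  rewrite rmorph_sum; apply: eq_bigr => k _; exact: (iter_commute k (re_sigma_inl X)).
have [d dE] : exists d : nat -> R1, forall k, ctrace p (ca_act S1) (c k * y) = i (d k).
  have [|d dE] := @choice nat R1 (fun k a => ctrace p (ca_act S1) (c k * y) = i a).
    by move=> k; apply: Galois_ctrace.
  by exists d.
have uE' : u = \sum_(k < n) il (i (d k)) * j (rho ^+ k).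
  rewrite -[LHS]mulr1 -(rmorph1 il) -y1 -iltr -ctraceZ // uE mulr_suml.
  rewrite (big_morph (ctrace p sg) (ctraceD p sg) (_ : _ = 0)); last first.
    by rewrite /ctrace big1 // => k _; rewrite rmorph0.
  apply: eq_bigr => k _; rewrite -mulrA mulrCA ctraceZ ?re_sigma_inr //.
  by rewrite -rmorphM iltr dE mulrC.
exists (fun m => \sum_(k < n) d k *~ ((rho ^+ k : Zrho p) : {poly int})`_m).
rewrite uE'; under eq_bigr => k _ do
  rewrite [rho ^+ k](Zrho_expand_lt p_prime) rmorph_sum mulr_sumr.
rewrite exchange_big; apply: eq_bigr => m _; rewrite !rmorph_sum mulr_sumr.
apply: eq_bigr => k _; rewrite rmorphM rmorph_int !rmorphMz mulrzl mulrzAr mulrzAr.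
by rewrite mulrC.
Qed.

(** The variables go to the coefficients of [u], so that [z] goes to [u] and [C] to a product of
    conjugates of the unit [1 + u eta^p]. The equation of [theta] and the formula for [tau theta]
    become the two relations assumed on [th1]. *)
Lemma generic_specialization u th1 :
  is_unit (1 + u * j eta ^+ p) -> sg u = u -> sg th1 = j rho * th1 + 1 ->
  isog D j th1 = tnorm D t (j eta ^+ p) (j (delta D) ^+ p) u ->
  fg_muln (j eta) (ns D) th1
    = fg_add (j eta) (fg_muln (j eta ^+ p) (nr D) u * j eta ^+ p.-1)
        (j (delta D) * t th1) ->
  exists (Psi : {rmorphism gR G -> X}) (Phi : {rmorphism Sring D (gloc G) -> X}),
    [/\ forall r, Phi (inc D (gloc G) r) = Psi r,
        forall r, sg (Psi r) = Psi r, forall r, t (Psi r) = Psi (gtauR G r),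
        forall x, Phi (gsigma G x) = sg (Phi x) &
        forall x, Phi (gtau G x) = t (Phi x)].
Proof.
move=> uu su sth1 isth1 tth1.
have [c uE] := re_sigma_fixed su.
have [P [PC PX]] := @mpoly_lift p.-1 (Zrho p) X j (fun k => il (i (c k))).
have Pz : P (zP p) = u.
  rewrite uE rmorph_sum; apply: eq_bigr => k _; rewrite rmorphM PX; congr (_ * _).
  exact: PC.
have Pt f : t (P f) = P (tauP D f).
  apply: (mpoly_ext (F := GRing.RMorphism.clone _ _ (t \o P) _)
    (G := GRing.RMorphism.clone _ _ (P \o tauP D) _)) => [z|k] /=.
    by rewrite map_mpolyC !PC re_tau_inr.
  by rewrite map_mpolyX !PX re_tau_inl.
have Ps f : sg (P f) = P f.
  apply: (mpoly_ext (F := GRing.RMorphism.clone _ _ (sg \o P) _) (G := P)) => [z|k] /=.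
    by rewrite !PC re_sigma_inr.
  by rewrite !PX re_sigma_inl ca_act_struct.
have uC : is_unit (P (CP D)).
  rewrite rmorph_prod; apply: is_unit_prod => k _; rewrite -(iter_commute k Pt).
  apply: (rmorph_is_unit (GRing.RMorphism.clone _ _ (iter k t) _)).
  by rewrite rmorph1DM Pz PC rmorphXn.
have [Psi PsiE] := localization_lift (glocP G) uC.
have PsiT r : t (Psi r) = Psi (gtauR G r).
  apply: (localization_ext (glocP G) (F := GRing.RMorphism.clone _ _ (t \o Psi) _)
    (G := GRing.RMorphism.clone _ _ (Psi \o gtauR G) _)) => f /=.
  by rewrite gtauRE !PsiE Pt.
have PsiS r : sg (Psi r) = Psi r.
  apply: (localization_ext (glocP G) (F := GRing.RMorphism.clone _ _ (sg \o Psi) _)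
    (G := Psi)) => f /=.
  by rewrite !PsiE Ps.
have [|Phi [PhiC PhiX]] := @qpoly_lift (gR G) _ (mk_monic_hpoly D (gloc G) p_prime) X Psi th1.
  move=> F FC FX; rewrite (@isog_theta_hpoly p D G X F j) => [|z].
    rewrite FX FC PsiE isth1 normPE.
    rewrite (@rmorph_tnorm p D (PolyR p) X P (tauP D) t _ _ _ Pt) Pz !PC !rmorphXn.
    by rewrite subrr.
  by rewrite FC PsiE PC.
have PhiI r : Phi (inc D (gloc G) r) = Psi r by apply: PhiC.
have Phij z : Phi (jS G z) = j z by rewrite [LHS]PhiI PsiE PC.
have PhizS : Phi (zS G) = u by rewrite [LHS]PhiI PsiE Pz.
exists Psi, Phi; split=> //.
  apply: (qpoly_ext (F := GRing.RMorphism.clone _ _ (Phi \o gsigma G) _)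
    (G := GRing.RMorphism.clone _ _ (sg \o Phi) _)) => [r|] /=.
    by rewrite gsigma_inc PhiI PsiS.
  rewrite gsigma_theta rmorphD rmorphM rmorph1 [Phi (qpolyX _)]PhiX sth1.
  by rewrite ScstE Phij.
apply: (qpoly_ext (F := GRing.RMorphism.clone _ _ (Phi \o gtau G) _)
  (G := GRing.RMorphism.clone _ _ (t \o Phi) _)) => [r|] /=.
  by rewrite gtau_inc !PhiI PsiT.
(* The relation for [tau theta] determines it: the unit [delta] and the formal summand beside it can
   be cancelled. *)
rewrite PhiX; have udl := rmorph_is_unit j (is_unit_delta p_prime D).
apply: (is_unit_mulIr udl); rewrite ![_ * j _]mulrC.
have uy : is_unit (1 + fg_muln (j eta ^+ p) (nr D) u * j eta ^+ p.-1 * j eta).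
  by rewrite -mulrA -exprSr prednK // one_fg_muln; apply: is_unitX.
apply: (fg_addIr uy); rewrite [LHS]fg_addC [RHS]fg_addC -tth1.
have /(congr1 Phi) := tau_theta G.
rewrite rmorph_fg_muln rmorph_fg_add !rmorphM rmorph_fg_muln !rmorphXn !Phij PhizS.
by rewrite [Phi (theta _ _)]PhiX.
Qed.

End Specialization.

Theorem theorem2p7 (p : nat) (p_prime : prime p) (D : cyclo_data p)
    (G : generic_ext D)
    (R1 : comPzRingType) (R1_semilocal : semilocal R1)
    (S1 : cyclic_alg R1) (S1_Galois : is_Galois p S1) :
  exists psi : {rmorphism Rtau G -> R1},
    cyclic_alg_iso S1 (base_change (Stau G) psi).
Proof.
have [X] := rho_extension_exists p_prime D (ca_act S1).
have [_ inji fixE _] := S1_Galois.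
have [x0 [ux0 sx0]] := semilocal_generator p_prime R1_semilocal S1_Galois X.
have [u [th1 [uu su sth1 isth1 tth1]]] := twisted_kummer_generator p_prime
  (re_tau_inr X) (re_sigma_inr X) (re_sigma_tau (X := X))
  (re_tau_order p_prime (X := X)) ux0 sx0.
have [Psi [Phi [PhiI PsiS PsiT PhiS PhiT]]] :=
  generic_specialization p_prime G S1_Galois uu su sth1 isth1 tth1.
have inl_inj : injective (re_inl X) by apply: re_inl_inj.
(* [Psi] maps [Rtau] into the elements of [X] fixed by [tau] and [sigma], that is into [R1]. *)
have [||psi psiE] := @rmorphism_factor R1 (Rtau G) X
  (GRing.RMorphism.clone _ _ (re_inl X \o ca_struct S1) _)
  (GRing.RMorphism.clone _ _ (Psi \o (val : Rtau G -> gR G)) _).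
- by move=> r r' /inl_inj/inji.
- move=> x /=; have [|a aE] := @re_tau_fixed p p_prime D _ _ X (Psi (val x)).
    by rewrite PsiT fixed_ringP.
  have [|r rE] := fixE a; last by exists r; rewrite aE rE.
  by apply: inl_inj; rewrite -re_sigma_inl -aE PsiS.
(* Likewise [Phi] maps [Stau] into the elements fixed by [tau], that is into [S1]. *)
have [|phi phiE] := @rmorphism_factor S1 (Stau G) X (re_inl X)
  (GRing.RMorphism.clone _ _ (Phi \o (val : Stau G -> Sring D (gloc G))) _) inl_inj.
  by move=> x /=; apply: (re_tau_fixed p_prime); rewrite -PhiT fixed_ringP.
exists psi; apply: (Galois_base_change_iso (prime_gt0 p_prime) (phi := phi)) => //.
- exact: Stau_Galois.
- by move=> r; apply: inl_inj; rewrite phiE [RHS]psiE /= PhiI.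
- by move=> x; apply: inl_inj; rewrite phiE /= PhiS -re_sigma_inl phiE.
Qed.
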